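(* Let $2\le e\le n$ and $d\ge 3$ be integers and let $C\subset\mathbb{P}^n$ be the rational normal curve of degree $e$. (a) For every choice of integers $a_1,\dots,a_{e-2}\ge 0$ and $b_{e+1},\dots,b_n\ge 0$ with $\sum_{i=1}^{e-2}a_i+\sum_{j=e+1}^{n}b_j=e(d-1)-2$, there exists a hypersurface $X\subset\mathbb{P}^n$ of degree $d$ containing $C$ and smooth along $C$ such that $$N_{C/X}\cong E=\left(\bigoplus_{i=1}^{e-2}\mathcal{O}(e+2-a_i)\right)\oplus\left(\bigoplus_{j=e+1}^{n}\mathcal{O}(e-b_j)\right).$$ (b) If $X\subset\mathbb{P}^n$ is a hypersurface of degree $d$ containing $C$ and smooth along $C$, and $N_{C/X}$ is not isomorphic to any bundle $E$ of the form described in (a), then $e<n-1$ and $$N_{C/X}\cong E'=\mathcal{O}(e+2)^{e-1}\oplus\left(\bigoplus_{j=e+2}^{n}\mathcal{O}(e-b_j)\right)$$ for some integers $b_j\ge 0$ with $\sum_{j=e+2}^{n}b_j=e(d-1)$. Moreover, when $e<n-1$, for every choice of integers $b_{e+2},\dots,b_n\ge 0$ with $\sum_{j=e+2}^{n}b_j=e(d-1)$ there exists a hypersurface $X\subset\mathbb{P}^n$ of degree $d$ containing $C$ and smooth along $C$ with $N_{C/X}\cong E'$.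
   Context: We work over an algebraically closed field $K$ of arbitrary characteristic, with homogeneous coordinates $x_0,\dots,x_n$ on $\mathbb{P}^n$. For $e\le n$, the rational normal curve of degree $e$ in $\mathbb{P}^n$ is the image $C$ of $\mathbb{P}^1\to\mathbb{P}^n$, $(s:t)\mapsto(s^e:s^{e-1}t:\cdots:st^{e-1}:t^e:0:\cdots:0)$. A hypersurface $X$ containing $C$ is smooth along $C$ if no point of $C$ is a singular point of $X$. The normal bundle $N_{C/X}$ is regarded as a vector bundle on $\mathbb{P}^1\cong C$, and $\mathcal{O}(k)=\mathcal{O}_{\mathbb{P}^1}(k)$. Empty sums are $0$ and empty direct sums are zero. *)

(* Defs.v *)
From HB Require Import structures.
From mathcomp Require Import all_boot all_order all_algebra.
From mathcomp Require Import boolp functions zify.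
From mathcomp.multinomials Require Import mpoly.

Set Implicit Arguments.
Unset Strict Implicit.
Unset Printing Implicit Defensive.

Import Order.TTheory GRing.Theory Num.Theory.
Local Open Scope ring_scope.

Local Notation "x %:F" := (@FracField.tofrac _ x).

(* Points of P^1 are represented by nonzero row vectors (s, t) of homogeneous
   coordinates; every property of points used below is invariant under scaling.
   The field Frac K[s,t] contains the sections of every O(k) over every
   nonempty open set. *)
Definition Kst (K : closedFieldType) := {fraction {mpoly K[2]}}.

(* Every nonempty Zariski open subset of P^1 is the locus D(g) where some
   nonzero form g in K[s,t] does not vanish. *)
Record openP1 (K : closedFieldType) := OpenP1 {
  open_form : {mpoly K[2]};
  open_deg : nat;
  open_homog : open_form \is open_deg.-homog;
  open_neq0 : open_form != 0 }.

Definition in_open (K : closedFieldType) (U : openP1 K) (v : 'rV[K]_2) : Prop :=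
  v != 0 /\ (open_form U).@[v ord0] != 0.

Definition sub_open (K : closedFieldType) (V U : openP1 K) : Prop :=
  forall v, in_open V v -> in_open U v.

(* The stalk of O(k) at v: fractions a/b of forms with deg a - deg b = k and
   b(v) != 0. *)
Definition twist_at (K : closedFieldType) (k : int) (v : 'rV[K]_2) (r : Kst K) :
    Prop :=
  exists (i j : nat) (a b : {mpoly K[2]}),
    [/\ a \is i.-homog, b \is j.-homog, i%:Z = k + j%:Z, b.@[v ord0] != 0
      & r = a%:F / b%:F].

(* r is a section of O(k) over U; in particular twist 0 is the structure sheaf. *)
Definition twist (K : closedFieldType) (k : int) (U : openP1 K) (r : Kst K) :
    Prop :=
  forall v, in_open U v -> twist_at k v r.

(* A sheaf of O-modules on P^1, given as a subsheaf of the constant sheaf of a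
   Frac K[s,t]-vector space; the restriction maps are inclusions.  As P^1 is
   irreducible, any two nonempty open sets meet, so sections that agree on
   overlaps are the same element of the ambient space, and gluing amounts to
   the locality condition sections_glue. *)
Record sheafP1 (K : closedFieldType) := SheafP1 {
  ambient : lmodType (Kst K);
  sections : openP1 K -> ambient -> Prop;
  sections0 : forall U, sections U 0;
  sectionsP : forall U (c : Kst K) x y, twist 0 U c ->
    sections U x -> sections U y -> sections U (c *: x + y);
  sections_res : forall U V x, sub_open V U -> sections U x -> sections V x;
  sections_glue : forall U x,
    (forall v, in_open U v ->
       exists V, [/\ in_open V v, sub_open V U & sections V x]) ->
    sections U x }.

Arguments sections {K} _ _ _.

(* f U and g U are mutually inverse O(U)-linear bijections between E(U) and
   E'(U), compatible with restriction; their values outside E(U) and E'(U) are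
   irrelevant. *)
Definition sheaf_iso (K : closedFieldType) (E E' : sheafP1 K) : Prop :=
  exists (f : openP1 K -> ambient E -> ambient E')
         (g : openP1 K -> ambient E' -> ambient E),
  [/\ forall U x, sections E U x -> sections E' U (f U x) /\ g U (f U x) = x,
      forall U y, sections E' U y -> sections E U (g U y) /\ f U (g U y) = y,
      forall U (c : Kst K) x y, twist 0 U c -> sections E U x -> sections E U y ->
        f U (c *: x + y) = c *: f U x + f U y
    & forall U V x, sub_open V U -> sections E U x -> f V x = f U x].

Section TwistTheory.
Variable K : closedFieldType.
Implicit Types (U V : openP1 K) (v : 'rV[K]_2) (r : Kst K) (k : int).

Lemma twist_at0 k v : v != 0 -> twist_at k v 0.
Proof.
case/rV0Pn => i vi; exists (absz (k + (absz k)%:Z)), (absz k), 0, ('X_i ^+ absz k).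
split; rewrite ?tofrac0 ?mul0r ?dhomog0 //.
- have hX : ('X_i : {mpoly K[2]}) \is 1.-homog by rewrite dhomogX /= mdeg1.
  by have := dhomogMn (absz k) hX; rewrite mul1n.
- by lia.
- by rewrite rmorphXn /= mevalXU expf_neq0.
Qed.

Lemma twist_at_lin k v (c x y : Kst K) :
  twist_at 0 v c -> twist_at k v x -> twist_at k v y -> twist_at k v (c * x + y).
Proof.
move=> [i0] [j0] [a0] [b0] [ha0 hb0 e0 n0 ->].
move=> [i1] [j1] [a1] [b1] [ha1 hb1 e1 n1 ->].
move=> [i2] [j2] [a2] [b2] [ha2 hb2 e2 n2 ->].
have F_neq0 (b : {mpoly K[2]}) : b.@[v ord0] != 0 -> b%:F != 0.
  by rewrite tofrac_eq0; apply: contraNneq => ->; rewrite meval0.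
have deg : (i0 + i1 + j2 = i2 + (j0 + j1))%N by lia.
exists (i0 + i1 + j2)%N, (j0 + j1 + j2)%N,
  (a0 * a1 * b2 + a2 * (b0 * b1)), (b0 * b1 * b2); split.
- by apply: rpredD; [|rewrite deg]; do !apply: dhomogM.
- by do !apply: dhomogM.
- by lia.
- by rewrite !rmorphM /= !mulf_neq0.
- rewrite mulf_div addf_div ?mulf_neq0 ?F_neq0 //.
  by rewrite rmorphD !rmorphM.
Qed.

Lemma in_open_ex U : exists v, in_open U v.
Proof.
case: U => g j hg g0; rewrite /in_open /=.
pose h (i : 'I_2) : {poly K} := if i == 0 then 1 else 'X.
pose p : {poly K} := mmap polyC h g.
have pE : p = \sum_(m <- msupp g) g@_m *: 'X^(m ord_max).
  rewrite /p /mmap; apply: eq_bigr => m _; rewrite /mmap1 !big_ord_recl big_ord0.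
  rewrite mul_polyC /h /= expr1n mul1r mulr1; congr (_ *: 'X^(m _)).
  exact/val_inj.
have p0 : p != 0.
  apply: contraNneq g0 => p0; apply/eqP/mpolyP => m; rewrite mcoeff0.
  apply/eqP; apply: contraT => gm.
  have ms : m \in msupp g by rewrite mcoeff_msupp.
  have := congr1 (fun q : {poly K} => q`_(m ord_max)) p0.
  rewrite pE coef0 coef_sum (bigD1_seq m) ?msupp_uniq //=.
  rewrite coefZ coefXn eqxx mulr1 big_seq_cond big1 ?addr0 => [/eqP|m'].
    by rewrite (negPf gm).
  case/andP=> m's m'm; rewrite coefZ coefXn; case: eqP => [e1|]; rewrite ?mulr0 //.
  case/eqP: m'm; have dg := dhomog_mf hg.
  have := dg _ ms; rewrite -(dg _ m's) /= !mdegE !big_ord_recl !big_ord0.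
  have -> : lift ord0 ord0 = ord_max :> 'I_2 by apply/val_inj.
  rewrite e1 !addn0 => /eqP; rewrite eqn_add2r => /eqP e0.
  apply/mnmP => i; case: (unliftP ord0 i) => [i' ->|-> //].
  by rewrite (_ : lift _ _ = ord_max) //; apply/val_inj; rewrite (ord1 i').
have [x px] := closed_nonrootP p p0.
pose v : 'rV[K]_2 := \row_i (if i == 0 then 1 else x).
exists v; split.
  by apply/rV0Pn; exists ord0; rewrite mxE eqxx oner_eq0.
apply: contraNneq px => gv; rewrite rootE -gv pE mevalE horner_sum.
apply/eqP/eq_bigr => m _; rewrite hornerZ hornerXn !big_ord_recl big_ord0 !mxE /=.
rewrite expr1n mul1r mulr1; congr (_ * x ^+ (m _)).
exact/val_inj.
Qed.

Lemma twist_res k U V r : sub_open V U -> twist k U r -> twist k V r.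
Proof. by move=> VU Ur v /VU; apply: Ur. Qed.

Lemma twist_glue k U r :
  (forall v, in_open U v ->
     exists V, [/\ in_open V v, sub_open V U & twist k V r]) ->
  twist k U r.
Proof. by move=> h v /h [V [Vv _]]; apply. Qed.

End TwistTheory.

(* The direct sum of the line bundles O(k) for k in ks. *)
Section LineSum.
Variables (K : closedFieldType) (ks : seq int).

Definition line_sum_sections (U : openP1 K) (x : 'rV[Kst K]_(size ks)) : Prop :=
  forall i : 'I_(size ks), twist ks`_i U (x ord0 i).

Program Definition line_sum : sheafP1 K :=
  @SheafP1 K 'rV[Kst K]_(size ks) line_sum_sections _ _ _ _.
Next Obligation. by move=> i v [v0 _]; rewrite mxE; apply: twist_at0. Qed.
Next Obligation.
by move=> i v Uv; rewrite !mxE; apply: twist_at_lin; [apply: H|apply: H0|apply: H1].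
Qed.
Next Obligation. by move=> i; apply: twist_res (H0 i). Qed.
Next Obligation.
by move=> i; apply: twist_glue => v /H [V [Vv VU Vx]]; exists V; split.
Qed.

End LineSum.

(* The forms (s^e, s^(e-1) t, ..., t^e, 0, ..., 0) in K[s,t]. *)
Definition rnc_forms (K : closedFieldType) (n e : nat) :
    n.+1.-tuple {mpoly K[2]} :=
  [tuple if (i <= e)%N then 'X_ord0 ^+ (e - i) * 'X_ord_max ^+ i else 0 | i < n.+1].

Definition rnc_point (K : closedFieldType) (n e : nat) (v : 'rV[K]_2) :
    'I_n.+1 -> K :=
  fun i => (tnth (rnc_forms K n e) i).@[v ord0].

Arguments rnc_point {K} n e v.

(* As K is algebraically closed, the vectors rnc_point n e v with v != 0 are
   all the representatives of all the points of C, so this also defines the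
   homogeneous ideal of C. *)
Definition vanishes_on_rnc (K : closedFieldType) (n e : nat)
    (F : {mpoly K[n.+1]}) : Prop :=
  forall v : 'rV[K]_2, v != 0 -> F.@[rnc_point n e v] = 0.

Definition singular_at (K : closedFieldType) (n : nat) (F : {mpoly K[n.+1]})
    (x : 'I_n.+1 -> K) : Prop :=
  F.@[x] = 0 /\ forall i, (F^`M(i)).@[x] = 0.

Definition hypersurface_smooth_along_rnc (K : closedFieldType) (n e d : nat)
    (F : {mpoly K[n.+1]}) : Prop :=
  [/\ F != 0, F \is d.-homog, vanishes_on_rnc e F
    & forall v : 'rV[K]_2, v != 0 -> ~ singular_at F (rnc_point n e v)].

(* The normal sheaf Hom(J/J^2, O_C), for J = I_C/(F) the ideal sheaf of C in
   X = V(F), pulled back along the isomorphism P^1 -> C.  Its sections over U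
   are the O_X-linear maps J -> O_C over U, which kill J^2 since J acts by zero
   on O_C.  By the correspondence between graded modules and sheaves on P^n,
   these are the graded K[x_0, ..., x_n]-linear maps psi, killing F, from the
   homogeneous ideal I_C to the direct sum over m of the
   O_C(m)(U) = O_{P^1}(e m)(U), on which a polynomial a acts through its
   pullback a(s^e, ..., t^e, 0, ..., 0).  Outside I_C, psi is set to 0. *)
Section NormalSheaf.
Variables (K : closedFieldType) (n e : nat) (F : {mpoly K[n.+1]}).

Definition normal_sections (U : openP1 K) (psi : {mpoly K[n.+1]} -> (Kst K)^o) :
    Prop :=
  [/\ forall a p q, vanishes_on_rnc e p -> vanishes_on_rnc e q ->
        psi (a * p + q) = (a \mPo rnc_forms K n e)%:F * psi p + psi q,
      forall m p, vanishes_on_rnc e p -> p \is m.-homog ->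
        twist (e * m)%N U (psi p),
      psi F = 0
    & forall p, ~ vanishes_on_rnc e p -> psi p = 0].

Program Definition normal_sheaf : sheafP1 K :=
  @SheafP1 K ({mpoly K[n.+1]} -> (Kst K)^o) normal_sections _ _ _ _.
Next Obligation.
split=> //= [a p q _ _|m p _ _ v [v0 _]]; last exact: twist_at0.
by rewrite mulr0 addr0.
Qed.
Next Obligation.
case: H0 H1 => [lx tx Fx ox] [ly ty Fy oy].
have E p : (c *: x + y) p = c * x p + y p by [].
split=> [a p q hp hq|m p hp hm v Uv||p hp]; rewrite !E.
- rewrite lx // ly // !mulrDr mulrCA !addrA; congr (_ + _).
  by rewrite -!addrA; congr (_ + _); rewrite addrC.
- by apply: twist_at_lin; [apply: H|apply: tx|apply: ty].
- by rewrite Fx Fy mulr0 addr0.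
- by rewrite ox // oy // mulr0 addr0.
Qed.
Next Obligation.
case: H0 => lx tx Fx ox; split=> // m p hp hm.
exact: twist_res (tx m p hp hm).
Qed.
Next Obligation.
have [v0 /H [V [_ _ [lx _ Fx ox]]]] := in_open_ex U.
split=> // m p hp hm; apply: twist_glue => v /H [V' [Vv VU [_ tx _ _]]].
by exists V'; split=> //; apply: tx.
Qed.

End NormalSheaf.

Definition bundle_E (K : closedFieldType) (e : nat) (a b : seq nat) : sheafP1 K :=
  line_sum K ([seq e%:Z + 2 - ai%:Z | ai <- a] ++ [seq e%:Z - bj%:Z | bj <- b]).

Definition bundle_E' (K : closedFieldType) (e : nat) (b : seq nat) : sheafP1 K :=
  line_sum K (nseq (e - 1) (e%:Z + 2) ++ [seq e%:Z - bj%:Z | bj <- b]).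

(* Main.v *)
Require Import Defs.
From HB Require Import structures.
From mathcomp Require Import all_boot all_order all_algebra.
From mathcomp Require Import boolp functions perm zify ring.
From mathcomp.multinomials Require Import mpoly.

(** The normal bundle of C in P^n is the sum of e - 1 copies of O(e + 2) and
n - e copies of O(e), and N_{C/X} is the kernel of the map to O(ed) given by F.
The proof makes this map explicit, decides which maps occur, and then does
linear algebra over K[s,t].

Coordinates. Let I be the homogeneous ideal of C. A linear map psi from I to
K(s,t) is determined by its values on x_(i-1) x_(i+1) - x_i^2 for 0 < i < e and
on x_j for j > e. Dividing the former by s^(e-1-i) t^(i-1) gives n - 1
coordinates c_al of psi, and psi(p) = sum_al c_al A_al(p) (conormal_expansion),
where A_al(p), called conormal below, is a form whenever p is homogeneous
(conormal_form). Writing psi = sum_k v_k d/dx_k with v_k = w_k s^(e-k) t^k, the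
first e - 1 coordinates are the second differences of the sequence w, up to
monomial factors. In these coordinates the sections of N_{C/X} are the vectors
c with sum_al c_al A_al(F) = 0, with c_al a section of O(e + 2) or of O(e)
(normal_coord_twist), and X is smooth along C if and only if the forms A_al(F)
have no common zero (singular_on_rncP). For d >= 3 every vector of monomials of
the right degrees is (A_al(F))_al for some F (conormal_lift,
conormal_realize).

Kernels. The kernel of a row of forms without common zero is a direct sum of
line bundles: starting from the Koszul relations, as long as the chosen
relations become dependent at some point, a combination of them can be divided
by the linear form of that point, which lowers the degree of a maximal minor
(kernel_basis_exists). Relations that are independent at every point give the
isomorphism with a sum of line bundles (normal_sheaf_split), and the comparison
of their minors with the given forms yields the sum of their degrees
(kernel_basis_deg).

Existence. By Hilbert-Burch the bidiagonal matrix with prescribed powers of s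
on the diagonal and of t next to it is a basis of relations of its maximal
minors, which are monomials (bidiagonal_basis); so they come from some F. For E'
this is applied to the last n - e coordinates only, the others being 0.

Classification. All degrees k_i of the kernel are at most e + 2. A relation
with k_i > e involves only the first e - 1 coordinates. If these coordinates of
F are not all 0, at most e - 2 such relations exist (few_large_degrees), and the
kernel has the form E. If they are all 0, the kernel is O(e + 2)^(e-1) plus the
kernel of the other n - e forms, which is E'. *)

Set Implicit Arguments.
Unset Strict Implicit.
Unset Printing Implicit Defensive.

Import Order.TTheory GRing.Theory Num.Theory.
Local Open Scope ring_scope.

(** * Forms in two variables *)

Lemma mpoly_ring_ind (n : nat) (R : comNzRingType) (P : {mpoly R[n]} -> Prop) :
  (forall c, P c%:MP) -> (forall i, P 'X_i) ->
  (forall p q, P p -> P q -> P (p + q)) ->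
  (forall p q, P p -> P q -> P (p * q)) -> forall p, P p.
Proof.
move=> PC PX PD PM p; rewrite [p]mpolyE; apply: big_ind => //.
  by rewrite -mpolyC0; apply: PC.
move=> m _; rewrite -mul_mpolyC; apply: (PM) => //; rewrite mpolyXE_id.
apply: (big_ind P) => [|//|i _]; first by rewrite -mpolyC1; apply: PC.
elim: (m i) => [|k IH]; first by rewrite expr0 -mpolyC1; apply: PC.
by rewrite exprS; apply: PM.
Qed.

Section BinaryForms.
Variable K : closedFieldType.
Local Notation R := {mpoly K[2]}.
Implicit Types (p q g : R) (k l : int) (v w : 'rV[K]_2).

Local Notation S := ('X_ord0 : R).
Local Notation T := ('X_ord_max : R).

(** The degree is an integer, so that degrees can be subtracted freely; the only
form of negative degree is 0. *)
Definition form k p : bool := (p == 0) || ((0 <= k) && (p \is `|k|%N.-homog)).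

Lemma form0 k : form k 0.
Proof. by rewrite /form eqxx. Qed.

Lemma formE (i : nat) p : form i%:Z p = (p \is i.-homog).
Proof. by rewrite /form /=; case: eqP => // ->; rewrite dhomog0. Qed.

Lemma form_neq0 k p : form k p -> p != 0 -> exists2 i : nat, k = i%:Z & p \is i.-homog.
Proof.
by case/orP=> [->//|/andP[k0 hp] _]; exists `|k|%N => //; rewrite gez0_abs.
Qed.

Lemma formD k p q : form k p -> form k q -> form k (p + q).
Proof.
rewrite /form; case/orP=> [/eqP->|/andP[k0 hp]]; first by rewrite add0r.
case/orP=> [/eqP->|/andP[_ hq]]; first by rewrite addr0 k0 hp orbT.
by rewrite k0 rpredD ?orbT.
Qed.

Lemma formN k p : form k p -> form k (- p).
Proof. by rewrite /form oppr_eq0 rpredN. Qed.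

Lemma formZ k c p : form k p -> form k (c *: p).
Proof.
rewrite /form; case/orP=> [/eqP->|/andP[k0 hp]]; first by rewrite scaler0 eqxx.
by rewrite k0 rpredZ ?orbT.
Qed.

Lemma formM k l p q : form k p -> form l q -> form (k + l) (p * q).
Proof.
rewrite /form; case/orP=> [/eqP->|/andP[k0 hp]]; first by rewrite mul0r eqxx.
case/orP=> [/eqP->|/andP[l0 hq]]; first by rewrite mulr0 eqxx.
rewrite addr_ge0 // (_ : absz (k + l) = (absz k + absz l)%N); last by lia.
by rewrite dhomogM ?orbT.
Qed.

Lemma form1 : form 0 1.
Proof. by rewrite (formE 0) dhomog1. Qed.

Lemma formX i : form 1 'X_i.
Proof. by rewrite (formE 1) dhomogX /= mdeg1. Qed.

Lemma formXn k p (i : nat) : form k p -> form (k * i%:Z) (p ^+ i).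
Proof.
move=> hp; elim: i => [|i IH]; first by rewrite mulr0 expr0 form1.
by rewrite exprS intS mulrDr mulr1; apply: formM.
Qed.

Lemma form_sum (I : Type) (r : seq I) (P : pred I) (F : I -> R) k :
  (forall i, P i -> form k (F i)) -> form k (\sum_(i <- r | P i) F i).
Proof.
move=> h; elim/big_ind: _ => // [|x y hx hy]; [exact: form0|exact: formD].
Qed.

Lemma form_prod (I : Type) (r : seq I) (P : pred I) (F : I -> R) (k : I -> int) :
  (forall i, P i -> form (k i) (F i)) ->
  form (\sum_(i <- r | P i) k i) (\prod_(i <- r | P i) F i).
Proof.
move=> h; elim/big_rec2: _ => [|i y1 y2 Pi hy]; [exact: form1|].
by apply: formM; rewrite ?h.
Qed.

Lemma form_det m (A : 'M[R]_m) (k n : 'I_m -> int) :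
  (forall i j, form (n j - k i) (A i j)) ->
  form (\sum_j n j - \sum_i k i) (\det A).
Proof.
move=> hA; rewrite /determinant; apply: form_sum => s _.
rewrite -[X in form X _]add0r; apply: formM.
  rewrite -signr_odd; case: (odd _); rewrite ?expr0 ?expr1; last exact: form1.
  by apply: formN; apply: form1.
have -> : \sum_j n j = \sum_i n (s i) by rewrite (reindex_inj (@perm_inj _ s)).
by rewrite -sumrB; apply: form_prod.
Qed.

Lemma rev2_neq (i : 'I_2) : rev_ord i != i.
Proof. by case: i => [[|[|]]]. Qed.

Lemma big_I2 (A : Type) (idx : A) (op : Monoid.com_law idx) (j : 'I_2) (F : 'I_2 -> A) :
  \big[op/idx]_(i < 2) F i = op (F j) (F (rev_ord j)).
Proof.
rewrite (bigD1 j) //=; congr (op _ _); apply: big_pred1 => i /=.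
by case: i j => [[|[|]]] // ? [[|[|]]].
Qed.

Lemma mdeg2 (m : 'X_{1..2}) j : mdeg m = (m j + m (rev_ord j))%N.
Proof. by rewrite mdegE (big_I2 _ j). Qed.

Lemma mpoly2E p (j : 'I_2) :
  p = \sum_(m <- msupp p) p@_m *: ('X_j ^+ m j * 'X_(rev_ord j) ^+ m (rev_ord j)).
Proof.
rewrite {1}[p]mpolyE; apply: eq_bigr => m _; congr (_ *: _).
by rewrite mpolyXE_id (big_I2 _ j).
Qed.

Lemma meval2E p (v : 'I_2 -> K) (j : 'I_2) :
  p.@[v] = \sum_(m <- msupp p) p@_m * (v j ^+ m j * v (rev_ord j) ^+ m (rev_ord j)).
Proof. by rewrite mevalE; apply: eq_bigr => m _; rewrite (big_I2 _ j). Qed.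

(** Spans the linear forms that vanish at v. *)
Definition point_form v : R := v ord0 ord_max *: S - v ord0 ord0 *: T.

Lemma point_form_neq0 v : v != 0 -> point_form v != 0.
Proof.
move=> v0; apply: contraNneq v0 => l0; apply/eqP/rowP => j; rewrite mxE.
have h (m : 'X_{1..2}) : (point_form v)@_m = 0 by rewrite l0 mcoeff0.
have := h U_(ord0)%MM; have := h U_(ord_max)%MM.
rewrite /point_form !mcoeffB !mcoeffZ !mcoeffXU !mulr0 !mulr1 sub0r subr0.
move=> /eqP; rewrite oppr_eq0 => /eqP e0 e1.
case: (unliftP ord0 j) => [j' ->|->] //; rewrite (ord1 j') -e1; congr (v _ _).
exact: val_inj.
Qed.

(** Up to a nonzero factor, the linear form of v is symmetric in the two
variables. *)
Lemma point_form_rev v (j : 'I_2) :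
  exists2 c : K, c != 0 &
    c *: point_form v = v ord0 (rev_ord j) *: 'X_j - v ord0 j *: 'X_(rev_ord j).
Proof.
case: (unliftP ord0 j) => [j' ->|->]; rewrite /point_form.
  have -> : lift ord0 j' = ord_max :> 'I_2 by apply: val_inj; rewrite (ord1 j').
  have -> : rev_ord ord_max = ord0 :> 'I_2 by apply: val_inj.
  by exists (-1); [rewrite oppr_eq0 oner_eq0|rewrite scaleN1r opprB].
have -> : rev_ord ord0 = ord_max :> 'I_2 by apply: val_inj.
by exists 1; [rewrite oner_eq0|rewrite scale1r].
Qed.

Lemma row2_neq0 v : v != 0 -> exists j, v ord0 (rev_ord j) != 0.
Proof.
by case/rV0Pn => i vi; exists (rev_ord i); rewrite rev_ordK.
Qed.

(** Let v_j' be a nonzero coordinate of v. Modulo v_j' X_j - v_j X_j' a form p of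
degree i satisfies v_j'^i p = p(v_j' X_j, v_j' X_j') = p(v) X_j'^i. *)
Lemma form_factor k p v : form k p -> v != 0 -> p.@[v ord0] = 0 ->
  exists2 q, form (k - 1) q & p = point_form v * q.
Proof.
have [->|p0] := eqVneq p 0; first by exists 0; rewrite ?mulr0 ?form0.
move=> hp v0 pv; have [i -> {}hp] := form_neq0 hp p0.
have [j vj] := row2_neq0 v0; set j' := rev_ord j in vj.
have [c c0 lE] := point_form_rev v j; rewrite -/j' in lE.
set a := v ord0 j' *: 'X_j : R; set b := v ord0 j *: 'X_j' : R.
pose q := \sum_(m <- msupp p)
   (p@_m * v ord0 j' ^+ m j') *: ((\sum_(l < m j) a ^+ ((m j).-1 - l) * b ^+ l) * 'X_j' ^+ m j').
have pE : v ord0 j' ^+ i *: p = c *: (point_form v * q).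
  have -> : v ord0 j' ^+ i *: p = v ord0 j' ^+ i *: p - p.@[v ord0] *: 'X_j' ^+ i.
    by rewrite pv scale0r subr0.
  rewrite {1}(mpoly2E p j) (meval2E p _ j) scaler_sumr scaler_suml -sumrB.
  rewrite scalerAl lE -/a -/b mulr_sumr; rewrite big_seq [RHS]big_seq; apply: eq_bigr => m hm.
  have dm : i = (m j + m j')%N by rewrite -(dhomog_mf hp hm) /= (mdeg2 m j).
  rewrite -scalerAr [(a - b) * _]mulrA -subrXX /a /b !exprZn dm !exprD mulrBl scalerBr.
  rewrite -!scalerAl !scalerA; congr (_ *: _ - _); first by ring.
  by rewrite -/j'; congr (_ *: _); ring.
have hq : form (i%:Z - 1) q.
  rewrite /q big_seq; apply: form_sum => m hm; apply: formZ.
  have dm : i = (m j + m j')%N by rewrite -(dhomog_mf hp hm) /= (mdeg2 m j).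
  rewrite (_ : i%:Z - 1 = ((m j)%:Z - 1) + (m j')%:Z); last by rewrite dm; lia.
  apply: formM; last by rewrite -[X in form X _]mul1r; apply/formXn/formX.
  apply: form_sum => l _; have hl := ltn_ord l.
  rewrite (_ : _ - 1 = 1 * ((m j).-1 - l)%N%:Z + 1 * (l : nat)%:Z); last by lia.
  by apply: formM; apply/formXn/formZ/formX.
exists ((c / v ord0 j' ^+ i) *: q); first exact: formZ.
have vi0 : v ord0 j' ^+ i != 0 by rewrite expf_neq0.
apply: (scalerI vi0); rewrite pE -scalerAr scalerA; congr (_ *: _).
by rewrite mulrC divfK.
Qed.

(** Unless p vanishes at (1,0), p(x,1) has degree deg p > 0 in x, hence a root. *)
Lemma form_root k p : form k p -> p != 0 -> 0 < k ->
  exists2 v : 'rV[K]_2, v != 0 & p.@[v ord0] = 0.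
Proof.
move=> hp p0 k0; have [i ki {}hp] := form_neq0 hp p0.
pose w x : 'rV[K]_2 := \row_j (if j == ord0 then x else 1).
have w0 x : w x != 0.
  by apply/rV0Pn; exists ord_max; rewrite mxE /= oner_eq0.
pose u : 'rV[K]_2 := \row_j (if j == ord0 then 1 else 0).
have u0 : u != 0 by apply/rV0Pn; exists ord0; rewrite mxE /= oner_eq0.
have [pu|pu] := eqVneq (p.@[u ord0]) 0; first by exists u.
pose P : {poly K} := \sum_(m <- msupp p) p@_m *: 'X^(m ord0).
have Pi : P`_i = p.@[u ord0].
  rewrite (meval2E p _ ord0) coef_sum big_seq [RHS]big_seq; apply: eq_bigr => m hm.
  have dm : i = (m ord0 + m (rev_ord ord0))%N by rewrite -(dhomog_mf hp hm) /= (mdeg2 m ord0).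
  rewrite coefZ coefXn !mxE eqxx (negPf (rev2_neq _)) expr1n mul1r expr0n dm; congr (_ * _%:R).
  by congr nat_of_bool; lia.
have sP : size P != 1.
  apply: contraNneq pu => sP; rewrite -Pi nth_default ?sP //; lia.
have [x xP] := closed_rootP P sP.
exists (w x) => //; rewrite (meval2E p _ ord0); transitivity P.[x]; last exact/eqP.
rewrite horner_sum; apply: eq_bigr => m _.
rewrite hornerZ hornerXn !mxE eqxx (negPf (rev2_neq _)) expr1n mulr1 //.
Qed.

Lemma form0_const p : form 0 p -> exists c, p = c%:MP.
Proof.
rewrite (formE 0) => /dhomogP h; exists (p@_0%MM); apply/mpolyP => m; rewrite mcoeffC.
have [->|m0] := eqVneq m 0%MM; first by rewrite mulr1.
rewrite mulr0; apply: memN_msupp_eq0.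
by apply: contra m0 => /h /= /eqP; rewrite mdeg_eq0.
Qed.

(** As K is infinite, the powers of the second variable can be separated first,
then those of the first. Testing only points with nonzero first coordinate makes
this applicable to polynomials known off the origin, or where a power of that
coordinate is inverted. *)
Lemma mpoly2_vanish p : (forall v : 'rV[K]_2, v ord0 ord0 != 0 -> p.@[v ord0] = 0) -> p = 0.
Proof.
move=> h.
have big0P (Q : {poly K}) : (forall x, x != 0 -> Q.[x] = 0) -> Q = 0.
  move=> hQ; apply/eqP; apply: contraT => Q0.
  have [x] := closed_nonrootP ('X * Q) (mulf_neq0 (negbT (polyX_eq0 K)) Q0).
  rewrite rootE hornerM hornerX mulf_eq0 negb_or => /andP[x0].
  by rewrite hQ // eqxx.
have rE : rev_ord ord0 = ord_max :> 'I_2 by apply: val_inj.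
apply/mpolyP => m; rewrite mcoeff0; apply/eqP; apply: contraT => pm.
have ms : m \in msupp p by rewrite mcoeff_msupp.
pose Q : {poly K} := \sum_(m' <- msupp p | m' ord_max == m ord_max) p@_m' *: 'X^(m' ord0).
have Q0 : Q = 0.
  apply: (big0P) => x x0.
  pose P : {poly K} := \sum_(m' <- msupp p) (p@_m' * x ^+ m' ord0) *: 'X^(m' ord_max).
  have P0 : P = 0.
    apply: (big0P) => y _; pose v : 'rV[K]_2 := \row_j (if j == ord0 then x else y).
    have <- : p.@[v ord0] = P.[y]; last by apply: h; rewrite mxE eqxx.
    rewrite (meval2E p _ ord0) horner_sum; apply: eq_bigr => m' _.
    by rewrite hornerZ hornerXn !mxE rE /= mulrA.
  have := congr1 (fun q : {poly K} => q`_(m ord_max)) P0.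
  rewrite coef0 coef_sum => P0m; rewrite -[RHS]P0m /Q horner_sum big_mkcond /=.
  apply: eq_bigr => m' _; rewrite coefZ coefXn hornerZ hornerXn eq_sym.
  by case: eqP; rewrite ?mulr1 ?mulr0.
have := congr1 (fun q : {poly K} => q`_(m ord0)) Q0.
rewrite coef0 coef_sum big_mkcond (bigD1_seq m) ?msupp_uniq //= eqxx coefZ coefXn eqxx.
rewrite mulr1 big1 ?addr0 => [/eqP|m' m'm]; first by rewrite (negPf pm).
case: eqP => // e1; rewrite coefZ coefXn; case: eqP => [e0|]; rewrite ?mulr0 //.
case/eqP: m'm; apply/mnmP => i; case: (unliftP ord0 i) => [i' ->|-> //].
by rewrite (_ : lift _ _ = ord_max) //; apply/val_inj; rewrite (ord1 i').
Qed.

Lemma meval_neq0 p : p != 0 -> exists2 v : 'rV[K]_2, v != 0 & p.@[v ord0] != 0.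
Proof.
move=> p0; apply: contrapT => h; case/eqP: p0; apply: mpoly2_vanish => v v0.
apply/eqP; apply: contraT => pv; case: h; exists v => //.
by apply/rV0Pn; exists ord0.
Qed.

End BinaryForms.

(** * Maximal minors of a matrix of relations *)

Section Minors.

(** The cofactors along row i are those of the identity matrix. *)
Lemma det_row_id (R : comNzRingType) (n : nat) (u : 'rV[R]_n) (i : 'I_n) :
  \det (\matrix_(x, y) if x == i then u 0 y else (x == y)%:R) = u 0 i.
Proof.
set T := \matrix_(x, y) _; rewrite (expand_det_row T i).
have cofE j : cofactor T i j = (j == i)%:R.
  transitivity ((\adj (1%:M : 'M[R]_n)) j i); last by rewrite adj1 mxE.
  rewrite mxE /cofactor; congr (_ * \det _); apply/matrixP => x y.
  by rewrite !mxE eq_sym (negPf (neq_lift _ _)).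
rewrite (bigD1 i) //= big1 => [|j /negPf ji]; rewrite cofE ?ji ?mulr0 //.
by rewrite eqxx mulr1 addr0 mxE eqxx.
Qed.

(** Makes the maximal minors of A cofactors of a square matrix. *)
Definition add_row (R : Type) (r m : nat) (u : 'rV[R]_m) (A : 'M[R]_(r, m)) : 'M[R]_(r.+1, m) :=
  \matrix_(x, y) oapp (fun x' => A x' y) (u 0 y) (unlift ord0 x).

Lemma cofactor_add_row (R : comNzRingType) (r : nat) (u : 'rV[R]_r.+1) (A : 'M[R]_(r, r.+1)) i :
  cofactor (add_row u A) ord0 i = (-1) ^+ i * \det (col' i A).
Proof.
rewrite /cofactor; congr (_ * \det _); apply/matrixP => x y.
by rewrite !mxE liftK.
Qed.

(** Cramer's rule for A completed by the row e_j: this matrix Z maps G to a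
multiple of the first basis vector, and adj(Z) Z G = det(Z) G. *)
Lemma minor_syzygy (R : comNzRingType) (r : nat) (A : 'M[R]_(r, r.+1)) (G : 'cV[R]_r.+1)
    (i j : 'I_r.+1) :
  A *m G = 0 ->
  (-1) ^+ i * \det (col' i A) * G j 0 = (-1) ^+ j * \det (col' j A) * G i 0.
Proof.
move=> AG; set Z := add_row (delta_mx 0 j) A.
have detZ : \det Z = (-1) ^+ j * \det (col' j A).
  rewrite (expand_det_row Z ord0) (bigD1 j) //= big1 => [|x /negPf xj].
    by rewrite cofactor_add_row addr0 mxE unlift_none /= mxE !eqxx mul1r.
  by rewrite mxE unlift_none /= mxE xj andbF mul0r.
have ZG : Z *m G = G j 0 *: delta_mx ord0 0.
  apply/matrixP => x y; rewrite !mxE; case: (unliftP ord0 x) => [x'|] ->.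
    rewrite eq_sym (negPf (neq_lift _ _)) mulr0.
    have := congr1 (fun M : 'cV_r => M x' 0) AG; rewrite !mxE => AG'; rewrite -[RHS]AG'.
    by apply: eq_bigr => l _; rewrite mxE liftK (ord1 y).
  rewrite eqxx (bigD1 j) //= big1 => [|l /negPf lj].
    by rewrite mxE unlift_none /= mxE !eqxx (ord1 y) mul1r mulr1 addr0.
  by rewrite mxE unlift_none /= mxE lj andbF mul0r.
have := congr1 (fun M => (\adj Z *m M) i 0) ZG; rewrite /= mulmxA mul_adj_mx detZ.
rewrite mul_scalar_mx -scalemxAr mxE => ->; rewrite mxE -colE mxE mxE cofactor_add_row.
by rewrite mulrC.
Qed.

(** A row outside the row space completes A to an invertible matrix, whose
determinant is expanded along that row. *)
Lemma row_free_minor (F : fieldType) (r : nat) (A : 'M[F]_(r, r.+1)) :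
  row_free A -> exists j, \det (col' j A) != 0.
Proof.
move=> fA; pose u := nz_row (A^C)%MS.
have u0 : u != 0.
  rewrite nz_row_eq0 -mxrank_eq0 mxrank_compl (eqP fA); lia.
have uC : (u <= A^C)%MS := nz_row_sub _.
set Z := add_row u A.
have AZ : (A <= Z)%MS.
  apply/row_subP => x; rewrite (_ : row x A = row (lift ord0 x) Z) ?row_sub //.
  by apply/rowP => y; rewrite !mxE liftK.
have uZ : (u <= Z)%MS.
  rewrite (_ : u = row ord0 Z) ?row_sub //.
  by apply/rowP => y; rewrite !mxE unlift_none.
have dis : (A :&: u)%MS = 0.
  apply/eqP; rewrite -submx0 -(capmx_compl A) capmxS //.
have rk : \rank Z = r.+1.
  apply/eqP; rewrite eqn_leq rank_leq_row /=.
  apply: leq_trans (mxrankS (_ : (A + u)%MS <= Z)%MS); last by rewrite addsmx_sub AZ.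
  by rewrite mxrank_disjoint_sum // (eqP fA) rank_rV u0 addn1.
have : Z \in unitmx by rewrite -row_free_unit /row_free rk.
rewrite unitmxE unitfE => dZ; apply/existsP; apply: contraNT dZ.
rewrite negb_exists => /forallP h; rewrite (expand_det_row Z ord0) big1 // => j _.
by rewrite cofactor_add_row; have /negPn/eqP -> := h j; rewrite !mulr0.
Qed.

Lemma minor_row_free (F : fieldType) (r m : nat) (A : 'M[F]_(r, m)) (f : 'I_r -> 'I_m) :
  \det (colsub f A) != 0 -> row_free A.
Proof.
move=> dA; apply: inj_row_free => y yA.
have uB : colsub f A \in unitmx by rewrite unitmxE unitfE.
rewrite -[y](mulmxK uB) mulmx_colsub yA.
by rewrite (_ : colsub f 0 = 0) ?mul0mx //; apply/matrixP => a b; rewrite !mxE.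
Qed.

Lemma col'_colsub (F : Type) (r m : nat) (A : 'M[F]_(r, m)) j :
  col' j A = colsub (lift j) A.
Proof. by apply/matrixP => a b; rewrite !mxE. Qed.

End Minors.

(** * The kernel of a row of forms without common zero *)

Section Kernels.
Variable K : closedFieldType.
Local Notation R := {mpoly K[2]}.
Implicit Types (v : 'rV[K]_2).

Definition mx_at m n (v : 'rV[K]_2) (A : 'M[R]_(m, n)) := map_mx (meval (v ord0)) A.

Definition nowhere_zero m (G : 'cV[R]_m) : Prop :=
  forall v : 'rV[K]_2, v != 0 -> mx_at v G != 0.

(** Row i embeds the summand O(k i) into the sum of the O(N j). Independence of
the rows at every point makes their span a subbundle; for r = m - 1 it is the
whole kernel of G. *)
Definition kernel_basis m r (N : 'I_m -> int) (k : 'I_r -> int)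
    (G : 'cV[R]_m) (A : 'M[R]_(r, m)) : Prop :=
  [/\ forall i j, form (N j - k i) (A i j), A *m G = 0
    & forall v, v != 0 -> row_free (mx_at v A)].

Lemma mx_atM m n p v (A : 'M[R]_(m, n)) (B : 'M_(n, p)) :
  mx_at v (A *m B) = mx_at v A *m mx_at v B.
Proof. exact: map_mxM. Qed.

Lemma det_at m v (A : 'M[R]_m) : \det (mx_at v A) = (\det A).@[v ord0].
Proof. exact: det_map_mx. Qed.

Lemma mx_at_neq0P m n v (A : 'M[R]_(m, n)) : mx_at v A != 0 -> exists i j, (A i j).@[v ord0] != 0.
Proof.
move=> h; apply: contrapT => h'; case/eqP: h; apply/matrixP => i j; rewrite !mxE.
by apply/eqP; apply: contraT => /negP h2; case: h'; exists i, j; apply/negP.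
Qed.

Lemma mx_at_neq0 m n v (A : 'M[R]_(m, n)) i j : (A i j).@[v ord0] != 0 -> mx_at v A != 0.
Proof. by apply: contraNneq => /matrixP/(_ i j); rewrite !mxE => ->. Qed.

(** As neither G nor M has a zero, g and mu vanish at the same points. Both can be
divided by the linear form of such a zero, until they are constant. *)
Lemma proportional_form_deg m (G M : 'cV[R]_m) (a b : int) (g mu : R) :
  nowhere_zero G -> nowhere_zero M -> g != 0 -> mu != 0 ->
  form a g -> form b mu -> (forall j, g * M j 0 = G j 0 * mu) -> a = b.
Proof.
move=> nG nM; have [n] := ubnP `|a|%N; elim: n a b g mu => // n IH a b g mu.
rewrite ltnS => an g0 mu0 ha hb gM.
have [a' aE _] := form_neq0 ha g0; have [b' bE _] := form_neq0 hb mu0.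
have zero v : v != 0 -> (g.@[v ord0] == 0) = (mu.@[v ord0] == 0).
  move=> v0; apply/eqP/eqP => z.
    have [j [l]] := mx_at_neq0P (nG v v0); rewrite (ord1 l) => Gj.
    have /eqP := congr1 (meval (v ord0)) (gM j); rewrite !mevalM z mul0r eq_sym mulf_eq0.
    by rewrite (negPf Gj) => /eqP.
  have [j [l]] := mx_at_neq0P (nM v v0); rewrite (ord1 l) => Mj.
  have /eqP := congr1 (meval (v ord0)) (gM j); rewrite !mevalM z mulr0 mulf_eq0.
  by rewrite (negPf Mj) orbF => /eqP.
have step v : v != 0 -> g.@[v ord0] = 0 -> 0 < a -> a = b.
  move=> v0 gv a0; have /eqP muv : mu.@[v ord0] == 0 by rewrite -zero // gv.
  have [q hq gE] := form_factor ha v0 gv; have [q' hq' muE] := form_factor hb v0 muv.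
  have l0 := point_form_neq0 v0.
  suff : a - 1 = b - 1 by move/addIr.
  apply: (IH _ _ q q') => //; first by lia.
  - by apply: contraNneq g0 => q0; rewrite gE q0 mulr0.
  - by apply: contraNneq mu0 => q0; rewrite muE q0 mulr0.
  - by move=> j; apply: (mulfI l0); rewrite mulrA -gE gM muE mulrCA.
have [a0|] := ltP 0 a.
  by have [v v0 gv] := form_root ha g0 a0; apply: step v0 gv a0.
rewrite aE => a0; have {}aE : a = 0 by lia.
have [b0|] := ltP 0 b; last by lia.
have [v v0 /eqP] := form_root hb mu0 b0; rewrite -zero // => /eqP gv.
move: ha; rewrite aE => /form0_const [c gc].
by move: gv g0; rewrite gc mevalC => ->; rewrite mpolyC0 eqxx.
Qed.

Section Basis.
Variables (r : nat) (N : 'I_r.+1 -> int) (G : 'cV[R]_r.+1) (D : int).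
Hypothesis hG : forall j, form (D - N j) (G j 0).
Hypothesis nG : nowhere_zero G.

Lemma form_minor (k : 'I_r -> int) (A : 'M[R]_(r, r.+1)) j :
  (forall i l, form (N l - k i) (A i l)) ->
  form (\sum_l N l - N j - \sum_i k i) (\det (col' j A)).
Proof.
move=> hA; rewrite (bigD1_ord j) //= [N j + _]addrC addrK.
by apply: form_det => i l; rewrite mxE; apply: hA.
Qed.

Lemma ex_point : exists v : 'rV[K]_2, v != 0.
Proof. by exists (const_mx 1); apply/rV0Pn; exists ord0; rewrite mxE oner_eq0. Qed.

(** The signed maximal minors of A are proportional to G, and neither vector has
a zero; so they have the same degree. *)
Lemma kernel_basis_deg (k : 'I_r -> int) (A : 'M[R]_(r, r.+1)) :
  kernel_basis N k G A -> \sum_i k i = \sum_j N j - D.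
Proof.
move=> [hA AG fA]; pose M : 'cV[R]_r.+1 := \col_j ((-1) ^+ j * \det (col' j A)).
have syz i j : M i 0 * G j 0 = M j 0 * G i 0 by rewrite !mxE; apply: minor_syzygy.
have Mat v j : (M j 0).@[v ord0] = (-1) ^+ j * \det (col' j (mx_at v A)).
  rewrite mxE mevalM rmorphXn /= mevalN meval1 -det_at; congr (_ * \det _).
  by apply/matrixP => a b; rewrite !mxE.
have nM : nowhere_zero M.
  move=> v v0; have [j dj] := row_free_minor (fA v v0).
  by apply: (@mx_at_neq0 _ _ v M j 0); rewrite Mat mulf_neq0 // signr_eq0.
have hM j : form (\sum_l N l - N j - \sum_i k i) (M j 0).
  rewrite mxE -signr_odd; case: (odd j); rewrite ?expr0 ?expr1 ?mul1r ?mulN1r.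
    by apply/formN/form_minor.
  exact: form_minor.
have [v v0] := ex_point; have [j [l]] := mx_at_neq0P (nM v v0); rewrite (ord1 l) => Mj.
have Mj0 : M j 0 != 0 by apply: contraNneq Mj => ->; rewrite meval0.
have Gj0 : G j 0 != 0.
  have [i [l']] := mx_at_neq0P (nG v0); rewrite (ord1 l') => Gi.
  have Gi0 : G i 0 != 0 by apply: contraNneq Gi => ->; rewrite meval0.
  apply: contraNneq (mulf_neq0 Mj0 Gi0) => Gj; by rewrite syz Gj mulr0.
suff: D - N j = \sum_l N l - N j - \sum_i k i by lia.
apply: (proportional_form_deg nG nM Gj0 Mj0 (hG j) (hM j)) => i.
by rewrite mulrC syz mulrC.
Qed.

(** If the rows of A are dependent at v, some homogeneous combination of them is
divisible by the linear form of v; the quotient replaces a row that occurs in it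
and increases one degree by 1. *)
Lemma kernel_saturation_step (k : 'I_r -> int) (A : 'M[R]_(r, r.+1)) v j0 :
  (forall i l, form (N l - k i) (A i l)) -> A *m G = 0 ->
  v != 0 -> ~~ row_free (mx_at v A) ->
  exists k' (A' : 'M[R]_(r, r.+1)),
    [/\ forall i l, form (N l - k' i) (A' i l), A' *m G = 0,
        \sum_i k' i = \sum_i k i + 1
      & \det (col' j0 A) != 0 -> \det (col' j0 A') != 0].
Proof.
move=> hA AG v0 nfA.
have l0 := point_form_neq0 v0.
have [la la0 laA] : exists2 la : 'rV[K]_r, la != 0 & la *m mx_at v A = 0.
  apply: contrapT => h; case/negP: nfA; apply: inj_row_free => la laA.
  by apply/eqP; apply: contraT => la0; case: h; exists la.
have /rV0Pn[i1 lai1] := la0.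
(* Among the rows of the dependency choose one of largest form degree; the
   others reach it after multiplication by powers of h, which is nonzero at v. *)
have [i lai imin] : exists2 i, la 0 i != 0 & forall x, la 0 x != 0 -> k i <= k x.
  by case: (arg_minP k (P := fun i => la 0 i != 0) lai1) => i; exists i.
have [c vc] := row2_neq0 v0; set h := 'X_(rev_ord c) : R; set hv := v ord0 (rev_ord c).
pose d x := `|k x - k i|%N.
pose w x : R := if la 0 x == 0 then 0 else (la 0 x / hv ^+ d x) *: h ^+ d x.
have wat x : (w x).@[v ord0] = la 0 x.
  rewrite /w; case: eqP => [->|_]; first by rewrite meval0.
  by rewrite mevalZ rmorphXn /= mevalXU divfK // expf_neq0.
have hw x : form (k x - k i) (w x).
  rewrite /w; case: eqP => [_|/eqP lax]; first exact: form0.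
  apply: formZ; have := imin x lax => le.
  have -> : k x - k i = 1 * (d x)%:Z by rewrite /d; lia.
  by apply/formXn/formX.
have wi : w i = (la 0 i)%:MP.
  rewrite /w (negPf lai) /d subrr expr0 expr0 divr1.
  by rewrite -mul_mpolyC mulr1.
pose B y : R := \sum_x w x * A x y.
have hB y : form (N y - k i) (B y).
  apply: form_sum => x _; rewrite (_ : N y - k i = (k x - k i) + (N y - k x)); last by lia.
  by apply: formM.
have Bv y : (B y).@[v ord0] = 0.
  have := congr1 (fun M : 'rV_r.+1 => M 0 y) laA; rewrite !mxE => BE; rewrite -[RHS]BE.
  rewrite raddf_sum; apply: eq_bigr => x _; rewrite mxE -wat; exact: mevalM.
have [q hq qE] := fin_all_exists2 (fun y => form_factor (hB y) v0 (Bv y)).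
pose A' : 'M[R]_(r, r.+1) := \matrix_(x, y) if x == i then q y else A x y.
exists (fun x => if x == i then k i + 1 else k x), A'.
have qG : \sum_y q y * G y 0 = 0.
  apply: (mulfI l0); rewrite mulr0 mulr_sumr.
  under eq_bigr => y _ do rewrite mulrA -qE mulr_suml.
  rewrite exchange_big big1 //= => x _.
  have := congr1 (fun M : 'cV_r => M x 0) AG; rewrite !mxE => AGx.
  under eq_bigr => y _ do rewrite -mulrA.
  by rewrite -mulr_sumr AGx mulr0.
split.
- move=> x y; rewrite mxE; case: eqP => // _.
  by rewrite opprD addrA.
- apply/matrixP => x y; rewrite !mxE (ord1 y).
  have := congr1 (fun M : 'cV_r => M x 0) AG; rewrite !mxE => AGx.
  have [xi|xi] := eqVneq x i; [rewrite -[RHS]qG|rewrite -[RHS]AGx].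
    by apply: eq_bigr => z _; rewrite mxE xi eqxx.
  by apply: eq_bigr => z _; rewrite mxE (negPf xi).
- rewrite (bigD1 i) //= eqxx [\sum_i k i](bigD1 i) //= addrAC; congr (_ + _ + _).
  by apply: eq_bigr => x /negPf ->.
- move=> dA; apply: contraNneq dA => dA'.
  (* Both products are A with row i replaced by B, so their determinants agree. *)
  pose T1 : 'M[R]_r := \matrix_(x, y) if x == i then (\row_z w z) 0 y else (x == y)%:R.
  pose T2 : 'M[R]_r := \matrix_(x, y) if x == i then (\row_z (point_form v *+ (z ==
    i))) 0 y else (x == y)%:R.
  have TE : T1 *m col' j0 A = T2 *m col' j0 A'.
    apply/matrixP => x y; rewrite !mxE.
    have [xi|xi] := eqVneq x i.
      transitivity (B (lift j0 y)).
        by apply: eq_bigr => z _; rewrite !mxE xi eqxx.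
      rewrite (bigD1 i) //= !mxE xi !eqxx mulr1n big1 ?addr0 -?qE // => z zi.
      by rewrite !mxE eqxx (negPf zi) mulr0n mul0r.
    transitivity (A x (lift j0 y)).
      rewrite (bigD1 x) //= !mxE (negPf xi) eqxx mul1r big1 ?addr0 // => z zx.
      by rewrite !mxE (negPf xi) eq_sym (negPf zx) mul0r.
    rewrite (bigD1 x) //= !mxE (negPf xi) eqxx mul1r big1 ?addr0 // => z zx.
    by rewrite !mxE (negPf xi) eq_sym (negPf zx) mul0r.
  have := congr1 (@determinant _ _) TE; rewrite !det_mulmx dA' mulr0 /T1 det_row_id mxE wi.
  by move/eqP; rewrite mulf_eq0 mpolyC_eq0 (negPf lai).
Qed.

(** The Koszul relations G_j0 e_j - G_j e_j0 are saturated step by step. The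
minor without column j0 stays nonzero while its degree decreases, so that after
finitely many steps the rows are independent at every point. *)
Lemma kernel_basis_exists : exists (k : 'I_r -> int) (A : 'M[R]_(r, r.+1)), kernel_basis N k G A.
Proof.
have [v v0] := ex_point; have [j0 [l]] := mx_at_neq0P (nG v0); rewrite (ord1 l) => Gj0v.
have {Gj0v} Gj0 : G j0 0 != 0 by apply: contraNneq Gj0v => ->; rewrite meval0.
pose A0 : 'M[R]_(r, r.+1) := \matrix_(i, y)
  if unlift j0 y is Some y' then G j0 0 *+ (y' == i) else - G (lift j0 i) 0.
pose k0 (i : 'I_r) : int := N (lift j0 i) - D + N j0.
have hA0 i y : form (N y - k0 i) (A0 i y).
  rewrite mxE /k0; case: unliftP => [y'|] ->.
    case: eqP => [->|_]; rewrite ?mulr1n ?mulr0n ?form0 //.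
    by rewrite (_ : _ - _ = D - N j0) //; lia.
  by apply: formN; rewrite (_ : _ - _ = D - N (lift j0 i)) //; lia.
have A0G : A0 *m G = 0.
  apply/matrixP => i y; rewrite !mxE (ord1 y) (bigD1_ord j0) //= mxE unlift_none.
  rewrite (bigD1 i) //= mxE liftK eqxx mulr1n big1 => [|z zi].
    by rewrite addr0 mulNr [G j0 0 * _]mulrC addNr.
  by rewrite mxE liftK (negPf zi) mulr0n mul0r.
have dA0 : \det (col' j0 A0) != 0.
  rewrite (_ : col' j0 A0 = (G j0 0)%:M) ?det_scalar ?expf_neq0 //.
  by apply/matrixP => i y; rewrite !mxE liftK eq_sym.
suff H : forall (d : nat) (k : 'I_r -> int) (A :
  'M[R]_(r, r.+1)), (forall i l, form (N l - k i) (A i l)) -> A *m G = 0 ->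
    \det (col' j0 A) != 0 -> \sum_l N l - N j0 - \sum_i k i <= d%:Z ->
    exists (k : 'I_r -> int) (A : 'M[R]_(r, r.+1)), kernel_basis N k G A.
  by apply: (H (absz (\sum_l N l - N j0 - \sum_i k0 i)%R) k0 A0) => //; rewrite lez_abs.
elim=> [|d IH] k A hA AG dA le.
  have [fA|] := pselect (forall v, v != 0 -> row_free (mx_at v A)); first by exists k, A.
  move=> /existsNP[u /not_implyP[u0 /negP nf]].
  have [k' [A' [hA' A'G sk dA']]] := kernel_saturation_step j0 hA AG u0 nf.
  have [i + _] := form_neq0 (form_minor j0 hA') (dA' dA).
  by rewrite sk; move: le; move: (\sum_l N l) (\sum_i k i) => x y; lia.
have [fA|] := pselect (forall v, v != 0 -> row_free (mx_at v A)); first by exists k, A.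
move=> /existsNP[u /not_implyP[u0 /negP nf]].
have [k' [A' [hA' A'G sk dA']]] := kernel_saturation_step j0 hA AG u0 nf.
apply: (IH k' A' hA' A'G (dA' dA)).
by rewrite sk; move: le; move: (\sum_l N l) (\sum_i k i) => x y; lia.
Qed.

End Basis.

End Kernels.

(** * Derivations along the rational normal curve *)

Lemma mderivXU (R : comNzRingType) (n : nat) (i j : 'I_n) :
  'X_i^`M(j) = (i == j)%:R :> {mpoly R[n]}.
Proof.
rewrite mderivX mnm1E; case: eqP => [->|_]; last by rewrite scale0r.
rewrite scale1r (_ : U_(j) - U_(j) = 0)%MM ?mpolyX0 //.
by apply/mnmP => l; rewrite mnmBE subnn mnm0E.
Qed.

Lemma mderiv_comp (R : comNzRingType) (n k : nat) (lq : n.-tuple {mpoly R[k]}) (j : 'I_k)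
    (p : {mpoly R[n]}) :
  (p \mPo lq)^`M(j) = \sum_i (p^`M(i) \mPo lq) * (tnth lq i)^`M(j).
Proof.
elim/mpoly_ring_ind: p => [c|i|p q IHp IHq|p q IHp IHq].
- rewrite comp_mpolyC mderivC big1 // => i _.
  by rewrite mderivC comp_mpoly0 mul0r.
- rewrite comp_mpolyXU -tnth_nth (bigD1 i) //= big1 => [|l li].
    by rewrite mderivXU eqxx comp_mpoly1 mul1r addr0.
  by rewrite mderivXU eq_sym (negPf li) comp_mpoly0 mul0r.
- rewrite comp_mpolyD mderivD IHp IHq -big_split /=; apply: eq_bigr => i _.
  by rewrite mderivD comp_mpolyD mulrDl.
- rewrite rmorphM /= mderivM IHp IHq mulr_suml mulr_sumr -big_split /=.
  apply: eq_bigr => i _; rewrite mderivM comp_mpolyD !rmorphM /=; ring.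
Qed.

Lemma mpoly_euler (R : comNzRingType) (n m : nat) (p : {mpoly R[n]}) :
  p \is m.-homog -> \sum_i 'X_i * p^`M(i) = p *+ m.
Proof.
move=> hp; rewrite {2}[p]mpolyE -sumrMnl.
transitivity (\sum_i \sum_(a <- msupp p) p@_a *: ('X_i * 'X_[a]^`M(i))).
  apply: eq_bigr => i _; rewrite {1}[p]mpolyE raddf_sum mulr_sumr.
  by apply: eq_bigr => a _; rewrite /= mderivZ scalerAr.
rewrite exchange_big /= big_seq [RHS]big_seq; apply: eq_bigr => a ha.
rewrite -scaler_sumr scalerMnr; congr (_ *: _).
rewrite -(dhomog_mf hp ha) /= mdegE -sumrMnr; apply: eq_bigr => i _.
rewrite mderivX -scalerAr -mpolyXD.
have [->|ai] := eqVneq (a i) 0%N; first by rewrite mulr0n scale0r.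
rewrite addmC submK; first by rewrite scaler_nat.
apply/mnm_lepP => l; rewrite mnm1E; case: eqP => // <-; lia.
Qed.

Lemma mderiv_homog (R : comNzRingType) (n m : nat) (p : {mpoly R[n]}) (k : 'I_n) :
  p \is m.-homog -> if m is m'.+1 then p^`M(k) \is m'.-homog else p^`M(k) = 0.
Proof.
move=> hp; have deg a : (p^`M(k))@_a != 0 -> (mdeg a).+1 = m.
  rewrite mcoeff_mderiv => h; have : p@_(a + U_(k))%MM != 0.
    by apply: contraNneq h => ->; rewrite mul0rn.
  by rewrite -mcoeff_msupp => /(dhomog_mf hp) /= <-; rewrite mdegD mdeg1 addn1.
case: m hp deg => [|m] hp deg.
  by apply/mpolyP => a; rewrite mcoeff0; apply/eqP; apply: contraT => /deg.
by apply/dhomogP => a; rewrite mcoeff_msupp => /deg [].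
Qed.

Section Conormal.
Variables (K : closedFieldType) (n e : nat).
Hypotheses (he : (2 <= e)%N) (hen : (e <= n)%N).
Local Notation R := {mpoly K[2]}.
Local Notation P := {mpoly K[n.+1]}.
Local Notation S := ('X_ord0 : R).
Local Notation T := ('X_ord_max : R).
Implicit Types (p q a b : P) (v : 'rV[K]_2) (i k l m : nat).

Definition mon (a b : nat) : R := S ^+ a * T ^+ b.

Lemma monM (a1 b1 a2 binom2 : nat) : mon a1 b1 * mon a2 binom2 = mon (a1 + a2) (b1 + binom2).
Proof. by rewrite /mon !exprD; ring. Qed.

Lemma SE (a : nat) : S ^+ a = mon a 0.
Proof. by rewrite /mon mulr1. Qed.

Lemma TE (a : nat) : T ^+ a = mon 0 a.
Proof. by rewrite /mon mul1r. Qed.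

Lemma form_mon (a b : nat) : form (a + b)%N%:Z (mon a b).
Proof.
rewrite PoszD -[a%:Z]mul1r -[b%:Z]mul1r; apply: formM; exact/formXn/formX.
Qed.

Lemma X2_neq0 (i : 'I_2) : 'X_i != 0 :> R.
Proof. by rewrite -msupp_eq0 msuppX. Qed.

Lemma mon_neq0 (a b : nat) : mon a b != 0.
Proof. by rewrite mulf_neq0 // expf_neq0 // X2_neq0. Qed.

Lemma mon_at (a b : nat) v : (mon a b).@[v ord0] = v ord0 ord0 ^+ a * v ord0 ord_max ^+ b.
Proof. by rewrite mevalM !rmorphXn /= !mevalXU. Qed.

Definition pullback p : R := p \mPo rnc_forms K n e.
Local Notation I := (@vanishes_on_rnc K n e).
Definition var k : P := 'X_(inord k).

HB.instance Definition _ := GRing.RMorphism.copy pullback (comp_mpoly (rnc_forms K n e)).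

Lemma pullback_at p v : (pullback p).@[v ord0] = p.@[rnc_point n e v].
Proof. by rewrite /pullback comp_mpoly_meval. Qed.

Lemma idealP p : I p <-> pullback p = 0.
Proof.
split=> [h|h v _]; last by rewrite -pullback_at h meval0.
apply: mpoly2_vanish => v v0; rewrite pullback_at; apply: h.
by apply/rV0Pn; exists ord0.
Qed.

Lemma ideal0 : I 0. Proof. by move=> v _; rewrite meval0. Qed.

Lemma idealD p q : I p -> I q -> I (p + q).
Proof. by move=> hp hq v v0; rewrite mevalD hp ?hq ?addr0. Qed.

Lemma idealN p : I p -> I (- p).
Proof. by move=> hp v v0; rewrite mevalN hp ?oppr0. Qed.

Lemma idealB p q : I p -> I q -> I (p - q).
Proof. by move=> hp hq; apply/idealD/idealN. Qed.

Lemma idealM a p : I p -> I (a * p).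
Proof. by move=> hp v v0; rewrite mevalM hp ?mulr0. Qed.

Lemma tnth_rnc (k : 'I_n.+1) :
  tnth (rnc_forms K n e) k = if (k <= e)%N then mon (e - k) k else 0.
Proof. by rewrite tnth_mktuple. Qed.

Lemma pullback_var k : (k <= e)%N -> pullback (var k) = mon (e - k) k.
Proof.
by move=> ke; rewrite /pullback comp_mpolyXU -tnth_nth tnth_rnc inordK ?ke // ltnS (leq_trans ke).
Qed.

Lemma pullback_var_high k : (e < k <= n)%N -> pullback (var k) = 0.
Proof.
move=> ke; rewrite /pullback comp_mpolyXU -tnth_nth tnth_rnc inordK; last by lia.
by case: leqP => //; lia.
Qed.

Lemma form_pullback p m : p \is m.-homog -> form (e * m)%N%:Z (pullback p).
Proof.
move=> hp; rewrite /pullback comp_mpolyEX big_seq; apply: form_sum => a ha; apply: formZ.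
rewrite comp_mpolyX -(dhomog_mf hp ha) /= mdegE big_distrr /=.
rewrite (big_morph Posz PoszD (erefl _)); apply: form_prod => i _.
rewrite PoszM; apply: formXn; rewrite tnth_rnc; case: leqP => [ie|_]; last exact: form0.
by have := form_mon (e - i) i; rewrite subnK.
Qed.

(** Vector fields along the cone over C, with components c_k x_k in K[s,t]. *)
Definition pbder (x : 'I_n.+1 -> R) (c : nat -> nat) p : R :=
  \sum_k (x k * pullback p^`M(k)) *+ c k.

Lemma pbderD x c p q : pbder x c (p + q) = pbder x c p + pbder x c q.
Proof.
rewrite /pbder -big_split; apply: eq_bigr => k _ /=.
by rewrite mderivD rmorphD mulrDr mulrnDl.
Qed.

Lemma pbderM x c p q : pbder x c (p * q) = pullback p * pbder x c q + pullback q * pbder x c p.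
Proof.
rewrite /pbder !mulr_sumr -big_split; apply: eq_bigr => k _ /=.
rewrite mderivM rmorphD !rmorphM /= !mulrnAr -mulrnDl; congr (_ *+ _); ring.
Qed.

(** The derivation sending x_k to (k - i)^+ times its pullback takes values
divisible by t^(i+1), and the one with weights (i - k)^+ values divisible by
s^(e-i+1). The quotients chartS and chartT describe the i-th second difference
where s, respectively t, is invertible. *)
Definition chartS_coef i k : R := if (k <= e)%N then mon (e - k) (k - i.+1) else 0.
Definition chartS i p : R := pbder (fun k : 'I_n.+1 => chartS_coef i k) (fun k => k - i)%N p.
Definition chartT_coef i k : R := if (k <= e)%N then mon (i.-1 - k) k else 0.
Definition chartT i p : R := pbder (fun k : 'I_n.+1 => chartT_coef i k) (fun k => i - k)%N p.

(** Multiplies the pullback of a monomial by its total weight. *)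
Definition logder := pbder (tnth (rnc_forms K n e)).

Lemma logderD c p q : logder c (p + q) = logder c p + logder c q.
Proof. exact: pbderD. Qed.

Lemma logderM c p q : logder c (p * q) = pullback p * logder c q + pullback q * logder c p.
Proof. exact: pbderM. Qed.

Lemma logder_var c k : (k <= e)%N -> logder c (var k) = mon (e - k) k *+ c k.
Proof.
move=> ke; have kn : (k < n.+1)%N by lia.
rewrite /logder /pbder (bigD1 (inord k)) //= big1 => [|l /negPf lk].
  by rewrite mderivXU eqxx rmorph1 mulr1 tnth_rnc inordK // ke addr0.
by rewrite mderivXU eq_sym lk rmorph0 mulr0 mul0rn.
Qed.

Lemma logder_var_high c k : (e < k <= n)%N -> logder c (var k) = 0.
Proof.
move=> ke; have kn : (k < n.+1)%N by lia.
rewrite /logder /pbder (bigD1 (inord k)) //= big1 => [|l /negPf lk].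
  by rewrite tnth_rnc inordK // leqNgt; case/andP: ke => -> _; rewrite mul0r mul0rn addr0.
by rewrite mderivXU eq_sym lk rmorph0 mulr0 mul0rn.
Qed.

Lemma logder_add_weights c d p : logder c p + logder d p = logder (fun k => c k + d k)%N p.
Proof. by rewrite /logder /pbder -big_split; apply: eq_bigr => k _ /=; rewrite mulrnDr. Qed.

Lemma logder_chartS i p : T ^+ i.+1 * chartS i p = logder (fun k => k - i)%N p.
Proof.
rewrite /chartS /logder /pbder mulr_sumr; apply: eq_bigr => k _; rewrite tnth_rnc /chartS_coef.
case: leqP => ke; last by rewrite !mul0r !mul0rn mulr0.
have [ki|ki] := leqP k i; first by rewrite (eqP ki) !mulr0n mulr0.
by rewrite mulrnAr mulrA TE monM add0n subnKC.
Qed.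

Lemma logder_chartT i p : (i <= e)%N -> S ^+ (e - i).+1 * chartT i p = logder (fun k => i - k)%N p.
Proof.
move=> ie; rewrite /chartT /logder /pbder mulr_sumr; apply: eq_bigr => k _;
  rewrite tnth_rnc /chartT_coef.
case: leqP => ke; last by rewrite !mul0r !mul0rn mulr0.
have [ki|ki] := leqP i k; first by rewrite (eqP ki) !mulr0n mulr0.
rewrite mulrnAr mulrA SE monM add0n.
by rewrite (_ : (e - i).+1 + (i.-1 - k) = e - k)%N //; lia.
Qed.

(** Euler's identity. *)
Lemma logder_const_weight c m p : I p -> p \is m.-homog -> logder (fun=> c) p = 0.
Proof.
move=> /idealP Ip hp; rewrite /logder /pbder sumrMnl.
have -> : \sum_k tnth (rnc_forms K n e) k * pullback p^`M(k) = pullback (\sum_k 'X_k * p^`M(k)).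
  rewrite raddf_sum; apply: eq_bigr => k _; rewrite /= rmorphM /=; congr (_ * _).
  by rewrite /pullback comp_mpolyXU -tnth_nth.
by rewrite (mpoly_euler hp) rmorphMn /= Ip !mul0rn.
Qed.

Lemma mderiv_mon (a b : nat) : T * (mon a b)^`M(ord_max) = mon a b *+ b.
Proof.
rewrite /mon !mpolyXn -mpolyXD mderivX -scalerAr -mpolyXD.
rewrite mnmDE !mulmnE !mnm1E eqxx /= ?muln0 ?mul0n add0n ?mul1n ?muln1.
case: b => [|b]; first by rewrite scale0r.
rewrite scaler_nat; congr ('X_[_] *+ _); rewrite addmC submK //.
by apply/mnm_lepP => l; rewrite mnmDE !mulmnE !mnm1E; case: (ord_max == l); lia.
Qed.

(** By the chain rule this is t d/dt of the pullback of p. *)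
Lemma logder_id_weight p : I p -> logder id p = 0.
Proof.
move=> /idealP Ip.
have := mderiv_comp (rnc_forms K n e) ord_max p; rewrite -/(pullback p) Ip mderiv0 => /esym H.
have := congr1 (fun x => T * x) H; rewrite mulr0 mulr_sumr => {}H; rewrite -[RHS]H.
apply: eq_bigr => k _; rewrite mulrCA tnth_rnc; case: leqP => ke.
  by rewrite mderiv_mon mulrC -mulrnAr.
by rewrite mul0r mul0rn mderiv0 !mulr0.
Qed.

(** The weights differ by (k - i)^+ - (i - k)^+ = k - i, which combines the two
weights killed by I. Taking Euler's identity instead of s d/ds keeps this valid
when the characteristic divides e. *)
Lemma logder_sym i m p : I p -> p \is m.-homog ->
  logder (fun k => k - i)%N p = logder (fun k => i - k)%N p.
Proof.
move=> Ip hp.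
rewrite -[LHS]addr0 -(logder_const_weight i Ip hp) logder_add_weights.
rewrite -[RHS]addr0 -(logder_id_weight Ip) logder_add_weights.
by apply: eq_bigr => k _; congr (_ *+ _); lia.
Qed.

(** Coprimality of powers of the two variables: f vanishes at the zero of X_j, so
that one factor X_j can be cancelled at a time. *)
Lemma form_div (j : 'I_2) k l (d : int) (f g : R) :
  form d f -> 'X_j ^+ k * g = 'X_(rev_ord j) ^+ l * f ->
  exists2 q, form (d - k%:Z) q & f = 'X_j ^+ k * q.
Proof.
elim: k d f => [|k IH] d f hf E; first by exists f; rewrite ?subr0 ?expr0 ?mul1r.
pose v : 'rV[K]_2 := \row_x (x != j)%:R.
have vj : v ord0 j = 0 by rewrite mxE eqxx.
have vj' : v ord0 (rev_ord j) = 1 by rewrite mxE rev2_neq.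
have v0 : v != 0 by apply/rV0Pn; exists (rev_ord j); rewrite vj' oner_neq0.
have fv : f.@[v ord0] = 0.
  have := congr1 (meval (v ord0)) E; rewrite !mevalM !rmorphXn /= !mevalXU vj vj'.
  by rewrite expr1n mul1r exprS !mul0r.
have [q hq fE] := form_factor hf v0 fv.
have [c c0] := point_form_rev v j; rewrite vj vj' scale0r subr0 scale1r => lE.
have fE' : f = 'X_j * (c^-1 *: q).
  by rewrite -lE -scalerAl -scalerAr scalerA mulfV // scale1r.
have [|q' hq' qE] := IH (d - 1) (c^-1 *: q) (formZ _ hq).
  by apply: (mulfI (X2_neq0 j)); rewrite mulrA -exprS E fE' mulrCA.
exists q'; first by rewrite (_ : _ - _ = d - 1 - k%:Z) //; lia.
by rewrite fE' qE exprS mulrA.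
Qed.

Lemma form_pullback_deriv p m (k : 'I_n.+1) :
  p \is m.-homog -> form (e%:Z * m%:Z - e%:Z) (pullback p^`M(k)).
Proof.
case: m => [|m] /(mderiv_homog k) => [->|/form_pullback];
  first by rewrite /pullback comp_mpoly0 form0.
by rewrite (_ : (e * m)%N%:Z = e%:Z * m.+1%:Z - e%:Z) //; lia.
Qed.

Lemma form_chartS i m p : p \is m.-homog -> form (e%:Z * m%:Z - i%:Z - 1) (chartS i p).
Proof.
move=> hp; apply: form_sum => k _; rewrite /chartS_coef; case: leqP => ke; last first.
  by rewrite mul0r mul0rn form0.
have [ki|ki] := leqP k i; first by rewrite (eqP ki) mulr0n form0.
rewrite -scaler_nat; apply: formZ.
rewrite (_ : _ - 1 = (e - k + (k - i.+1))%N%:Z + (e%:Z * m%:Z - e%:Z)); last by lia.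
by apply: formM; [exact: form_mon|exact: form_pullback_deriv].
Qed.

(** The two expressions s^-(e-i+1) chartS and t^-(i+1) chartT of the i-th conormal
coordinate agree, so it has no poles. *)
Lemma chart_gluing i m p : (i <= e)%N -> I p -> p \is m.-homog ->
  exists2 f, form (e%:Z * m%:Z - (e%:Z + 2)) f &
    chartS i p = S ^+ (e - i).+1 * f /\ chartT i p = T ^+ i.+1 * f.
Proof.
move=> ie Ip hp.
have E : S ^+ (e - i).+1 * chartT i p = T ^+ i.+1 * chartS i p.
  by rewrite logder_chartS logder_chartT // (logder_sym i Ip hp).
have rE : rev_ord ord0 = ord_max :> 'I_2 by apply: val_inj.
have := @form_div ord0 (e - i).+1 i.+1 _ _ _ (form_chartS i hp); rewrite rE => /(_ _ E).
case=> f hf uE; exists f.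
  by rewrite (_ : _ - _ = e%:Z * m%:Z - i%:Z - 1 - (e - i).+1%:Z) //; lia.
split=> //; apply: (mulfI (expf_neq0 (e - i).+1 (X2_neq0 ord0))).
by rewrite E uE mulrCA.
Qed.

(** * Conormal coordinates *)

Local Notation FF x := (@FracField.tofrac R x).

Lemma FFM (x y : R) : FF (x * y) = FF x * FF y. Proof. exact: rmorphM. Qed.
Lemma FFD (x y : R) : FF (x + y) = FF x + FF y. Proof. exact: rmorphD. Qed.
Lemma FFB (x y : R) : FF (x - y) = FF x - FF y. Proof. exact: rmorphB. Qed.
Lemma FF0 : FF 0 = 0. Proof. exact: rmorph0. Qed.
Lemma FF1 : FF 1 = 1. Proof. exact: rmorph1. Qed.
Lemma FFN1 : FF (-1) = -1. Proof. exact: rmorphN1. Qed.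

Lemma chartSD i p q : chartS i (p + q) = chartS i p + chartS i q.
Proof. exact: pbderD. Qed.

Lemma chartSM i p q : chartS i (p * q) = pullback p * chartS i q + pullback q * chartS i p.
Proof. exact: pbderM. Qed.

Definition conormal_rank : nat := (e.-1 + (n - e))%N.
(** The degrees of the line bundles in N_{C/P^n}. *)
Definition normal_degree (al : nat) : int := if (al < e.-1)%N then e%:Z + 2 else e%:Z.

(** The coordinates of p in I/I^2: index al < e - 1 stands for the second
difference at i = al + 1, a larger al for the variable x_(al+2). *)
Definition conormal (al : nat) p : Kst K :=
  if (al < e.-1)%N then FF (chartS al.+1 p) / FF (S ^+ (e - al))
  else FF (pullback p^`M(inord al.+2)).

Lemma tofrac_neq0 (f : R) : f != 0 -> FF f != 0.
Proof. by rewrite tofrac_eq0. Qed.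

Lemma conormal_logder al p f : (al < e.-1)%N ->
  logder (fun k => k - al.+1)%N p = mon (e - al) al.+2 * f -> conormal al p = FF f.
Proof.
move=> ale; rewrite -logder_chartS TE => E; rewrite /conormal ale.
have {}E : chartS al.+1 p = S ^+ (e - al) * f.
  by apply: (mulfI (mon_neq0 0 al.+2)); rewrite E mulrA SE monM add0n addn0.
by rewrite E FFM mulrAC divff ?mul1r // tofrac_neq0 // expf_neq0 // X2_neq0.
Qed.

Lemma conormal_lin al a p q : I p -> I q ->
  conormal al (a * p + q) = FF (pullback a) * conormal al p + conormal al q.
Proof.
move=> /idealP Ip /idealP Iq; rewrite /conormal; case: ifP => _.
  by rewrite chartSD chartSM Ip mul0r addr0 FFD FFM mulrDl mulrA.
by rewrite mderivD mderivM 2!(rmorphD pullback) 2!(rmorphM pullback) /= Ip mulr0 add0r FFD FFM.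
Qed.

Lemma conormal0 al : conormal al 0 = 0.
Proof.
have := @conormal_lin al (-1) 0 0 ideal0 ideal0.
by rewrite mulr0 addr0 rmorphN1 FFN1 mulN1r addNr.
Qed.

Lemma conormalM al a p : I p -> conormal al (a * p) = FF (pullback a) * conormal al p.
Proof.
by move=> Ip; have := @conormal_lin al a p 0 Ip ideal0; rewrite conormal0 !addr0.
Qed.

Lemma conormalD al p q : I p -> I q -> conormal al (p + q) = conormal al p + conormal al q.
Proof.
by move=> Ip Iq; have := @conormal_lin al 1 p q Ip Iq; rewrite rmorph1 FF1 !mul1r.
Qed.

Lemma conormalB al p q : I p -> I q -> conormal al (p - q) = conormal al p - conormal al q.
Proof.
move=> Ip Iq; have := @conormal_lin al (-1) q p Iq Ip.
by rewrite rmorphN1 FFN1 !mulN1r => E; rewrite addrC E addrC.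
Qed.

Lemma conormal_form al m p : (al < conormal_rank)%N -> I p -> p \is m.-homog ->
  exists2 f, form (e%:Z * m%:Z - normal_degree al) f & conormal al p = FF f.
Proof.
move=> alr Ip hp; rewrite /normal_degree /conormal; case: ltnP => ale; last first.
  by exists (pullback p^`M(inord al.+2)) => //; apply: form_pullback_deriv.
have ie : (al.+1 <= e)%N by lia.
have [f hf [uE _]] := chart_gluing ie Ip hp.
exists f => //; rewrite uE (_ : (e - al.+1).+1 = e - al)%N; last by lia.
by rewrite FFM mulrAC divff ?mul1r // tofrac_neq0 // expf_neq0 // X2_neq0.
Qed.

(** * Lifting conormal vectors to hypersurfaces *)

Definition binom2 (a b c d : nat) : P := var a * var b - var c * var d.
Definition quadric i : P := binom2 i.-1 i.+1 i i.

Lemma var_homog k : var k \is 1.-homog.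
Proof. by rewrite dhomogX /= mdeg1. Qed.

Lemma binom2_homog (a b c d : nat) : binom2 a b c d \is 2.-homog.
Proof. by apply: rpredB; apply: (@dhomogM _ _ _ 1 _ 1); apply: var_homog. Qed.

Section Binomials.
Variables (a b c d : nat).
Hypotheses (ha : (a <= e)%N) (hb : (b <= e)%N) (hc : (c <= e)%N) (hd : (d <= e)%N).
Hypothesis (habcd : (a + b = c + d)%N).

Lemma ideal_binom2 : I (binom2 a b c d).
Proof.
apply/idealP; rewrite /binom2 raddfB /= !rmorphM /= !pullback_var // !monM habcd.
rewrite (_ : e - a + (e - b) = e - c + (e - d))%N ?subrr //; lia.
Qed.

Lemma logder_binom2 (h : nat -> nat) : logder h (binom2 a b c d) =
  mon (e + e - (a + b)) (a + b) *+ (h a + h b) - mon (e + e - (a + b)) (a + b) *+ (h c + h d).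
Proof.
have E x y : (x <= e)%N -> (y <= e)%N ->
    logder h (var x * var y) = mon (e + e - (x + y)) (x + y) *+ (h x + h y).
  move=> xe ye; rewrite logderM !logder_var // !pullback_var // !mulrnAr !monM addnC addrC mulrnDr.
  by congr (mon _ _ *+ _ + mon _ _ *+ _); lia.
have thN p : logder h (- p) = - logder h p.
  apply/eqP; rewrite -addr_eq0 -logderD addNr /logder /pbder big1 // => k _.
  by rewrite raddf0 rmorph0 mulr0 mul0rn.
by rewrite /binom2 logderD thN !E // habcd.
Qed.

Lemma conormal_binom2_high al : (e.-1 <= al < conormal_rank)%N -> conormal al (binom2 a b c d) = 0.
Proof.
case/andP=> ale alr; have alr' : (al.+2 < n.+1)%N by move: alr; rewrite /conormal_rank; lia.
have D x : (x <= e)%N -> (var x)^`M(inord al.+2) = 0.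
  move=> xe; rewrite mderivXU -val_eqE /= !inordK //; last by lia.
  by rewrite (_ : (x == al.+2) = false) //; lia.
rewrite /conormal ltnNge ale /= /binom2 mderivB !mderivM !D //.
by rewrite !mul0r !mulr0 !addr0 subr0 rmorph0 FF0.
Qed.

End Binomials.

Lemma ideal_quadric i : (0 < i < e)%N -> I (quadric i).
Proof. by move=> ie; apply: ideal_binom2; lia. Qed.

(** The sequence k |-> (k - i)^+ has second difference 1 at i and 0 elsewhere. *)
Lemma conormal_quadric i al : (0 < i < e)%N -> (al < conormal_rank)%N ->
  conormal al (quadric i) = FF (mon (e - i.+1) i.-1 *+ (al.+1 == i)).
Proof.
move=> ie alr; have [ale|ale] := ltnP al e.-1; last first.
  rewrite conormal_binom2_high ?ale //; try lia.
  by rewrite (_ : (_ == i) = false) ?mulr0n ?FF0 //; lia.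
apply: conormal_logder => //; rewrite logder_binom2; try lia.
rewrite (_ : i.-1 + i.+1 = i + i)%N; last by lia.
case: ltngtP => hi; rewrite ?mulr0n ?mulr0 ?mulr1n.
- rewrite (_ : i.-1 - al.+1 + (i.+1 - al.+1) = i - al.+1 + (i - al.+1))%N ?subrr //; lia.
- rewrite (_ : i.-1 - al.+1 + (i.+1 - al.+1) = 0)%N; last by lia.
  by rewrite (_ : i - al.+1 + (i - al.+1) = 0)%N ?subrr //; lia.
rewrite -hi monM (_ : al.+1.-1 - al.+1 + (al.+2 - al.+1) = 1)%N; last by lia.
rewrite (_ : al.+1 - al.+1 + (al.+1 - al.+1) = 0)%N; last by lia.
by rewrite mulr0n subr0 mulr1n; congr mon; lia.
Qed.

(** x_(i+1) x_(r-1) - 2 x_i x_r + x_(i-1) x_(r+1): its i-th coordinate is a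
monomial that need not be divisible by the i-th coordinate of quadric i. *)
Definition quadric_pair (i r : nat) : P := binom2 i.+1 r.-1 i r + binom2 i.-1 r.+1 i r.

Lemma ideal_quadric_pair i (r : nat) : (0 < i < e)%N -> (0 < r < e)%N -> I (quadric_pair i r).
Proof. by move=> ie re; apply: idealD; apply: ideal_binom2; lia. Qed.

Lemma conormal_quadric_pair i (r : nat) al : (0 < i < e)%N -> (0 < r < e)%N -> i != r ->
  (al < conormal_rank)%N ->
  conormal al (quadric_pair i r) =
  FF (mon (e - r.+1) r.-1 *+ (al.+1 == i) + mon (e - i.+1) i.-1 *+ (al.+1 == r)).
Proof.
move=> ie re ir alr; have [ale|ale] := ltnP al e.-1; last first.
  rewrite conormalD; try by apply: ideal_binom2; lia.
  rewrite !conormal_binom2_high ?ale //; try lia.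
  rewrite (_ : (_ == i) = false) ?mulr0n; last by lia.
  by rewrite (_ : (_ == r) = false) ?mulr0n ?addr0 ?FF0 //; lia.
apply: conormal_logder => //; rewrite logderD !logder_binom2; try lia.
rewrite (_ : i.+1 + r.-1 = i + r)%N; last by lia.
rewrite (_ : i.-1 + r.+1 = i + r)%N; last by lia.
set M := mon _ (i + r).
rewrite addrACA -!mulrnDr -opprD -mulrnDr.
set A := (X in M *+ X - _); set B := (X in _ - M *+ X).
have -> : A = (B + (al.+1 == i) + (al.+1 == r))%N by rewrite /A /B; lia.
rewrite -addnA mulrnDr addrC addrA addNr add0r mulrDr !mulrnAr mulrnDr !monM.
by congr (_ + _); [case: eqP|case: eqP] => // hi; rewrite ?mulr0n // !mulr1n /M; congr mon; lia.
Qed.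

(** Factors x_e are split off as long as t^e divides; at most one factor other
than x_0 and x_e remains. *)
Lemma mono_lift l (x y : nat) : (x + y = e * l)%N ->
  exists2 a, a \is l.-homog & pullback a = mon x y.
Proof.
elim: l x y => [|l IH] x y.
  rewrite muln0 => /eqP; rewrite addn_eq0 => /andP[/eqP-> /eqP->].
  by exists 1; [exact: dhomog1|rewrite rmorph1 /mon !expr0 mulr1].
rewrite mulnS => xy; have [ye|ye] := leqP e y.
  have [|a ha pa] := IH x (y - e)%N; first by lia.
  exists (var e * a); first by apply: (@dhomogM _ _ _ 1) => //; apply: var_homog.
  by rewrite rmorphM /= pa pullback_var // monM subnn add0n subnKC.
have [|a ha pa] := IH (x - (e - y))%N 0%N; first by lia.
exists (var y * a); first by apply: (@dhomogM _ _ _ 1) => //; apply: var_homog.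
rewrite rmorphM /= pa pullback_var ?monM //; last by lia.
by congr mon; lia.
Qed.

Definition lifts (d al : nat) (f : R) p : Prop :=
  [/\ I p, p \is d.-homog & forall be, (be < conormal_rank)%N ->
    conormal be p = FF (f *+ (be == al))].

(** The r-th coordinate of the pair is cancelled by a multiple of quadric r. *)
Lemma lift_quadric_pair d i (r A B A' B' : nat) : (0 < i < e)%N -> (0 < r < e)%N -> i != r ->
  (A + B = e * d)%N -> (A' + B' = e * d)%N ->
  (e - i.+1 + A = e - r.+1 + A')%N -> (i.-1 + B = r.-1 + B')%N ->
  exists p, lifts d.+2 i.-1 (mon (e - r.+1 + A) (r.-1 + B)) p.
Proof.
move=> ie re ir AB AB' EA EB.
have [a ha pa] := mono_lift AB; have [a' ha' pa'] := mono_lift AB'.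
have Ig := ideal_quadric_pair ie re; have Iq := ideal_quadric re.
exists (a * quadric_pair i r - a' * quadric r); split.
- by apply: idealB; apply: idealM.
- apply: rpredB; rewrite -addn2; apply: dhomogM => //; last exact: binom2_homog.
  by apply: rpredD; apply: binom2_homog.
- move=> be ber; rewrite conormalB; try exact: idealM.
  rewrite !conormalM // conormal_quadric_pair // conormal_quadric // pa pa' -!FFM -FFB.
  congr (FF _); rewrite mulrDr !mulrnAr !monM [(A + (e - i.+1))%N]addnC [(B + i.-1)%N]addnC EA EB.
  rewrite [(A' + _)%N]addnC [(B' + _)%N]addnC addrK [(A + _)%N]addnC [(B + _)%N]addnC.
  by rewrite (_ : (be.+1 == i) = (be == i.-1)) //; lia.
Qed.

Lemma conormal_var al k : (e < k <= n)%N -> (al < conormal_rank)%N ->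
  conormal al (var k) = FF ((al.+2 == k)%:R).
Proof.
move=> ke alr; have [ale|ale] := ltnP al e.-1.
  apply: conormal_logder => //; rewrite logder_var_high // (_ : (_ == k) = false) ?mulr0 //; lia.
have alr' : (al.+2 < n.+1)%N by move: alr; rewrite /conormal_rank; lia.
rewrite /conormal ltnNge ale /= mderivXU -val_eqE /= !inordK //; last by lia.
by rewrite [k == _]eq_sym; case: eqP; rewrite ?rmorph1 ?rmorph0.
Qed.

Lemma ideal_var k : (e < k <= n)%N -> I (var k).
Proof. by move=> ke; apply/idealP; apply: pullback_var_high. Qed.

(** For i = al + 1 the multiples of quadric i give the monomials divisible by
s^(e-1-i) t^(i-1). If the exponent y of t is too small, the pair of i and
r = y + 1 times a power of x_0 is used; if the exponent x of s is too small, the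
pair of i and r = e - 1 - x times a power of x_e. Cubics and higher degrees
leave a linear factor for the correction in lift_quadric_pair. *)
Lemma conormal_lift d al (x y : nat) : (3 <= d)%N -> (al < conormal_rank)%N ->
  (x + y)%N%:Z + normal_degree al = e%:Z * d%:Z -> exists p, lifts d al (mon x y) p.
Proof.
case: d => [|[|d]] // hd alr; rewrite /normal_degree; case: ltnP => ale xy; last first.
  have [a ha pa] := @mono_lift d.+1 x y ltac:(lia).
  have Iv : I (var al.+2) by apply: ideal_var; move: alr; rewrite /conormal_rank; lia.
  exists (a * var al.+2); split; first exact: idealM.
  - rewrite -(addn1 d.+1); apply: dhomogM => //; apply: var_homog.
  - move=> be ber; rewrite conormalM // conormal_var //; last by move: alr;
    rewrite /conormal_rank; lia.
    by rewrite pa -FFM eqSS eqSS; case: eqP; rewrite ?mulr1 ?mulr0.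
have ed : (e <= e * d)%N by rewrite leq_pmulr.
have {}xy : (x + y + e + 2 = e * d + e + e)%N by lia.
have [f fE] : exists f, f = (e * d)%N by exists (e * d)%N.
rewrite -fE in ed xy.
have [y1|y1] := ltnP y al.
  have := @lift_quadric_pair d al.+1 y.+1 f 0 (f - (al - y)) (al - y).
  rewrite -fE (_ : mon _ _ = mon x y); last by congr mon; lia.
  by apply; lia.
have [x1|x1] := ltnP x (e - al.+2).
  have := @lift_quadric_pair d al.+1 (e - x.+1) 0 f (e - x.+1 - al.+1) (f - (e - x.+1 - al.+1)).
  rewrite -fE (_ : mon _ _ = mon x y); last by congr mon; lia.
  by apply; lia.
have [a ha pa] := @mono_lift d (x - (e - al.+2)) (y - al) ltac:(lia).
have ie : (0 < al.+1 < e)%N by lia.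
exists (a * quadric al.+1); split; first exact/idealM/ideal_quadric.
- by rewrite -addn2; apply: dhomogM => //; apply: binom2_homog.
- move=> be ber; rewrite conormalM ?conormal_quadric //; last exact: ideal_quadric.
  rewrite pa -FFM mulrnAr monM eqSS /=.
  by congr (FF (mon _ _ *+ _)); lia.
Qed.

(** * Linear maps on the ideal of the curve *)

Section Nondegenerate.
Variable psi : P -> Kst K.
Hypothesis psi_lin : forall a p q, I p -> I q -> psi (a * p + q) = FF (pullback a) * psi p + psi q.
Hypothesis psi_quadric : forall i, (0 < i < e)%N -> psi (quadric i) = 0.
Hypothesis psi_var : forall k, (e < k <= n)%N -> psi (var k) = 0.

(** J is an ideal. Modulo J one has x_0 x_(k+1) = x_1 x_k, so that a power of x_0
moves any polynomial into K[x_0, x_1]. *)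
Let J p := I p /\ psi p = 0.

Let J_lin a p q : J p -> J q -> J (a * p + q).
Proof.
move=> [Ip p0] [Iq q0]; split; first by apply: idealD => //; apply: idealM.
by rewrite psi_lin // p0 q0 mulr0 addr0.
Qed.

Let J0 : J 0.
Proof.
split; first exact: ideal0.
have := @psi_lin (-1) 0 0 ideal0 ideal0.
by rewrite mulr0 addr0 rmorphN1 FFN1 mulN1r addNr.
Qed.

Let JM a p : J p -> J (a * p).
Proof. by move=> Jp; rewrite -[a * p]addr0; apply: J_lin. Qed.

Let JD p q : J p -> J q -> J (p + q).
Proof. by move=> Jp Jq; rewrite -[p]mul1r; apply: J_lin. Qed.

Let cancel_pullback a p : pullback a != 0 -> I p -> psi (a * p) = 0 -> psi p = 0.
Proof.
move=> a0 Ip; have := @psi_lin a p 0 Ip ideal0; rewrite !addr0 => ->.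
by case: J0 => _ ->; rewrite addr0 => /eqP; rewrite mulf_eq0 tofrac_eq0 (negPf a0) => /eqP.
Qed.

(** x_(k-1) (x_0 x_(k+1) - x_1 x_k) is a combination of x_0 x_k - x_1 x_(k-1)
and quadric k, and x_(k-1) does not vanish identically on C. *)
Let J_binom2 k : (0 < k < e)%N -> J (binom2 0 k.+1 1 k).
Proof.
elim: k => // k IH /andP[_ ke].
have Ik : I (binom2 0 k.+2 1 k.+1) by apply: ideal_binom2; lia.
split=> //; have [->|k0] := posnP k; first by apply: (@psi_quadric 1); lia.
apply: (@cancel_pullback (var k)) => //; first by rewrite pullback_var ?mon_neq0 //; lia.
have -> : var k * binom2 0 k.+2 1 k.+1 = var k.+1 * binom2 0 k.+1 1 k + var 0 * quadric k.+1.
  rewrite /quadric /binom2 /=; ring.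
apply: (proj2 (J_lin _ _ _)); first by apply: IH; lia.
by apply: JM; split; [apply: ideal_quadric|apply: psi_quadric]; lia.
Qed.

Let comp2 (a : R) : P := a \mPo [tuple var 0; var 1].

Let reducible p := exists (N : nat) (a : R), J (var 0 ^+ N * p - comp2 a).

Let reducible_low k : (k <= e)%N -> reducible (var k).
Proof.
elim: k => [_|k IH ke].
  exists 0%N, 'X_ord0; rewrite /comp2 comp_mpolyXU expr0 mul1r subrr; exact: J0.
have [->|k0] := posnP k.
  by exists 0%N, 'X_ord_max; rewrite /comp2 comp_mpolyXU expr0 mul1r subrr; exact: J0.
have [N [a h]] := IH (ltnW ke); exists N.+1, ('X_ord_max * a).
have -> : comp2 ('X_ord_max * a) = var 1 * comp2 a.
  by rewrite /comp2 rmorphM /= comp_mpolyXU.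
have -> : var 0 ^+ N.+1 * var k.+1 - var 1 * comp2 a =
    var 0 ^+ N * binom2 0 k.+1 1 k + var 1 * (var 0 ^+ N * var k - comp2 a).
  rewrite /binom2 exprS; ring.
by apply: J_lin; [apply: J_binom2; rewrite k0|apply: JM].
Qed.

Let reducible_all p : reducible p.
Proof.
elim/mpoly_ring_ind: p => [c|i|p q [N [a hp]] [N' [a' hq]]|p q [N [a hp]] [N' [a' hq]]].
- exists 0%N, c%:MP; rewrite /comp2 comp_mpolyC expr0 mul1r subrr; exact: J0.
- have -> : 'X_i = var i by rewrite /var inord_val.
  have [ie|ie] := leqP i e; first exact: reducible_low.
  have hi : (e < i <= n)%N by rewrite ie /= -ltnS ltn_ord.
  exists 0%N, 0; rewrite /comp2 comp_mpoly0 subr0 expr0 mul1r; split; first exact: ideal_var.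
  exact: psi_var.
- exists (N + N')%N, ('X_ord0 ^+ N' * a + 'X_ord0 ^+ N * a').
  have -> : comp2 ('X_ord0 ^+ N' * a + 'X_ord0 ^+ N * a') =
      var 0 ^+ N' * comp2 a + var 0 ^+ N * comp2 a'.
    by rewrite /comp2 rmorphD !rmorphM /= !rmorphXn /= !comp_mpolyXU.
  have -> : var 0 ^+ (N + N') * (p + q) - (var 0 ^+ N' * comp2 a + var 0 ^+ N * comp2 a') =
     var 0 ^+ N' * (var 0 ^+ N * p - comp2 a) + var 0 ^+ N * (var 0 ^+ N' * q - comp2 a').
    rewrite exprD; ring.
  by apply: J_lin => //; apply: JM.
- exists (N + N')%N, (a * a').
  have -> : comp2 (a * a') = comp2 a * comp2 a' by rewrite /comp2 rmorphM.
  have -> : var 0 ^+ (N + N') * (p * q) - comp2 a * comp2 a' =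
     (var 0 ^+ N' * q) * (var 0 ^+ N * p - comp2 a) + comp2 a * (var 0 ^+ N' * q - comp2 a').
    rewrite exprD; ring.
  by apply: J_lin => //; apply: JM.
Qed.

(** The remainder a(x_0, x_1) of x_0^N p vanishes on C. Since K is algebraically
closed, (s^e, s^(e-1) t) takes every value with nonzero first coordinate, so
a = 0. *)
Lemma conormal_generated p : I p -> psi p = 0.
Proof.
move=> Ip; have [N [a [Ia psia]]] := reducible_all p.
suff a0 : a = 0.
  move: psia; rewrite a0 /comp2 comp_mpoly0 subr0; apply: cancel_pullback => //.
  by rewrite rmorphXn /= pullback_var // expf_neq0 // mon_neq0.
have {}Ia : I (comp2 a).
  rewrite -[comp2 a](subKr (var 0 ^+ N * p)); apply: idealB => //; exact: idealM.
apply: mpoly2_vanish => v v0.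
have [s sE] : exists s : K, s ^+ e = v ord0 ord0.
  have [|s] := closed_rootP ('X^e - (v ord0 ord0)%:P) _.
    by rewrite size_XnsubC //; lia.
  by rewrite rootE hornerD hornerN hornerXn hornerC subr_eq0 => /eqP; exists s.
have s0 : s != 0.
  by apply: contraNneq v0 => s0; rewrite -sE s0 expr0n (_ : (e == 0) = false) //; lia.
pose z : 'rV[K]_2 := \row_j (if j == ord0 then s else v ord0 ord_max / s ^+ e.-1).
have z0 : z != 0 by apply/rV0Pn; exists ord0; rewrite mxE.
have := Ia z z0; rewrite /comp2 comp_mpoly_meval => E; rewrite -[RHS]E.
apply: meval_eq => i.
have H k : (k <= e)%N -> (var k).@[rnc_point n e z] =
  s ^+ (e - k) * (v ord0 ord_max / s ^+ e.-1) ^+ k.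
  by move=> ke; rewrite -pullback_at pullback_var // mon_at !mxE.
case: (unliftP ord0 i) => [i'|] ->.
  rewrite (_ : lift _ _ = ord_max); last by apply: val_inj; rewrite /= (ord1 i').
  rewrite (tnth_nth 0) /= H; last by lia.
  by rewrite expr1 subn1 mulrC divfK // expf_neq0.
by rewrite (tnth_nth 0) /= H // subn0 expr0 mulr1 sE.
Qed.

End Nondegenerate.

(** The divisor is the value of the coordinate al on its quadric. *)
Definition normal_coord (psi : P -> Kst K) (al : nat) : Kst K :=
  if (al < e.-1)%N then psi (quadric al.+1) / FF (mon (e - al.+2) al) else psi (var al.+2).

(** The difference of the two sides kills every quadric i and x_j, j > e. *)
Lemma conormal_expansion (psi : P -> Kst K) p :
  (forall a p q, I p -> I q -> psi (a * p + q) = FF (pullback a) * psi p + psi q) ->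
  I p -> psi p = \sum_(al < conormal_rank) normal_coord psi al * conormal al p.
Proof.
move=> hpsi Ip.
pose phi q := psi q - \sum_(al < conormal_rank) normal_coord psi al * conormal al q.
suff : phi p = 0 by move=> /eqP; rewrite subr_eq0 => /eqP.
apply: conormal_generated => // [a q r Iq Ir|i ie|k ke]; rewrite /phi.
- rewrite hpsi // mulrBr addrACA -opprD; congr (_ + _ - _).
  rewrite mulr_sumr -big_split; apply: eq_bigr => al _ /=.
  by rewrite conormal_lin // mulrDr mulrCA.
- have ir : (i.-1 < conormal_rank)%N by rewrite /conormal_rank; lia.
  have ie' : (i.-1 < e.-1)%N by lia.
  have iE : i.-1.+1 = i by lia.
  rewrite (bigD1 (Ordinal ir)) //= big1 => [|al /negPf ali].
    rewrite conormal_quadric // iE eqxx mulr1n addr0 /normal_coord ie' iE.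
    by rewrite divfK ?subrr // tofrac_neq0 // mon_neq0.
  rewrite conormal_quadric // (_ : (al.+1 == i) = false) ?mulr0n ?FF0 ?mulr0 //.
  by move: ali; rewrite -val_eqE /=; lia.
- have ir : (k - 2 < conormal_rank)%N by rewrite /conormal_rank; lia.
  rewrite (bigD1 (Ordinal ir)) //= big1 => [|al /negPf ali].
    have kE : (k - 2).+2 = k by lia.
    rewrite conormal_var // kE eqxx FF1 addr0 mulr1 /normal_coord kE (_ :
      (_ < _)%N = false) ?subrr //.
    lia.
  rewrite conormal_var // (_ : (al.+2 == k) = false) ?FF0 ?mulr0 //.
  by move: ali; rewrite -val_eqE /=; lia.
Qed.

(** The system is triangular: equation i expresses D (i + 1) by the later D k, and
the remaining relation then gives D 0. *)
Lemma chart_system_inj (s t : K) (D : nat -> K) : s != 0 ->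
  (forall i, (i < e)%N -> \sum_(k < e.+1) (s ^+ (e - k) * t ^+ (k - i.+1) * D k) *+ (k - i) = 0) ->
  \sum_(k < e.+1) s ^+ (e - k) * t ^+ k * D k = 0 ->
  forall k, (k <= e)%N -> D k = 0.
Proof.
move=> s0 H H0.
have Dpos l : (l <= e)%N -> forall k, (e - l < k <= e)%N -> D k = 0.
  elim: l => [|l IH] le k kl; first by lia.
  have [kl'|kl'] := ltnP (e - l) k; first by apply: IH; lia.
  have [j jE] : exists j, j = (e - l.+1)%N by exists (e - l.+1)%N.
  have kE : k = j.+1 by lia.
  have ke : (j.+1 < e.+1)%N by lia.
  have := H j ltac:(lia).
  rewrite kE (bigD1 (Ordinal ke)) //= subSnn subnn big1 => [|x xk].
    rewrite expr0 mulr1 mulr1n addr0 => /eqP.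
    by rewrite mulf_eq0 expf_eq0 (negPf s0) andbF => /eqP.
  have [xk'|xk'] := leqP x j; first by rewrite (eqP xk') mulr0n.
  have hx := ltn_ord x; rewrite (IH _ x) ?mulr0 ?mul0rn //; first by lia.
  by move: xk; rewrite -val_eqE /=; lia.
case=> [_|k ke]; last by apply: (Dpos e) => //; rewrite subnn.
move: H0; rewrite (bigD1 ord0) //= big1 => [|x x0].
  by rewrite subn0 expr0 mulr1 addr0 => /eqP; rewrite mulf_eq0 expf_eq0 (negPf s0) andbF => /eqP.
rewrite (Dpos e) ?mulr0 // subnn; have := ltn_ord x; move: x0; rewrite -val_eqE /=; lia.
Qed.

Lemma pbder_at (x : nat -> R) c p v : (forall k, (e < k)%N -> x k = 0) ->
  (pbder (fun k : 'I_n.+1 => x k) c p).@[v ord0] =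
  \sum_(k < e.+1) ((x k).@[v ord0] * (pullback p^`M(inord k)).@[v ord0]) *+ c k.
Proof.
move=> x0; rewrite (big_ord_widen n.+1 (fun k =>
  ((x k).@[v ord0] * (pullback p^`M(inord k)).@[v ord0]) *+ c k)); last by lia.
rewrite [RHS]big_mkcond raddf_sum; apply: eq_bigr => k _; rewrite /= ltnS.
case: leqP => ke; first by rewrite mevalMn mevalM inord_val.
by rewrite x0 // mul0r mul0rn meval0.
Qed.

(** Where s is invertible, the numbers f_al(v) together with the vanishing of the
Euler derivation and of t d/dt on F form a triangular system for the partial
derivatives in x_0, ..., x_e. Where t is invertible, the system is the same
after k |-> e - k. *)
Lemma singular_on_rncP F d v (f : nat -> R) : I F -> F \is d.-homog -> v != 0 ->
  (forall al, (al < conormal_rank)%N -> conormal al F = FF (f al)) ->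
  (singular_at F (rnc_point n e v) <-> forall al, (al < conormal_rank)%N -> (f al).@[v ord0] = 0).
Proof.
move=> IF hF v0 fE; pose D k := (pullback F^`M(inord k)).@[v ord0].
set s := v ord0 ord0; set t := v ord0 ord_max.
have st : (s != 0) || (t != 0).
  apply: contraNT v0; rewrite negb_or !negbK => /andP[/eqP s0 /eqP t0].
  apply/eqP/rowP => j; rewrite mxE; case: (unliftP ord0 j) => [j'|] -> //.
  by rewrite (_ : lift _ _ = ord_max) //; apply: val_inj; rewrite /= (ord1 j').
have uE i : (chartS i F).@[v ord0] = \sum_(k < e.+1) (s ^+ (e - k) * t ^+ (k - i.+1) * D k) *+ (k - i).
  rewrite /chartS pbder_at => [|k ke]; last by rewrite /chartS_coef leqNgt ke.
  by apply: eq_bigr => k _; rewrite /chartS_coef -ltnS ltn_ord mon_at.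
have wE i : (chartT i F).@[v ord0] = \sum_(k < e.+1) (s ^+ (i.-1 - k) * t ^+ k * D k) *+ (i - k).
  rewrite /chartT pbder_at => [|k ke]; last by rewrite /chartT_coef leqNgt ke.
  by apply: eq_bigr => k _; rewrite /chartT_coef -ltnS ltn_ord mon_at.
have low al : (al < e.-1)%N -> chartS al.+1 F = S ^+ (e - al.+1).+1 * f al /\ chartT al.+1 F =
  T ^+ al.+2 * f al.
  move=> ale; have [g hg [uF wF]] := @chart_gluing al.+1 d F ltac:(lia) IF hF.
  suff -> : f al = g by [].
  apply/eqP; rewrite -(tofrac_eq (f al) g) -fE; last by rewrite /conormal_rank; lia.
  rewrite /conormal ale uF (_ : (e - al.+1).+1 = e - al)%N; last by lia.
  by rewrite FFM mulrAC divff ?mul1r // tofrac_neq0 // expf_neq0 // X2_neq0.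
have high al : (e.-1 <= al < conormal_rank)%N -> f al = pullback F^`M(inord al.+2).
  case/andP=> ale alr; apply/eqP; rewrite -(tofrac_eq (f al)) -fE //.
  by rewrite /conormal ltnNge ale.
split=> [[_ sing] al alr|f0].
  have D0 k : D k = 0 by rewrite /D pullback_at.
  have [ale|ale] := ltnP al e.-1; last by rewrite high ?ale // -/(D _) D0.
  have [uF wF] := low al ale.
  have : (chartS al.+1 F).@[v ord0] = 0 by rewrite uE big1 // => k _; rewrite D0 mulr0 mul0rn.
  have : (chartT al.+1 F).@[v ord0] = 0 by rewrite wE big1 // => k _; rewrite D0 mulr0 mul0rn.
  rewrite uF wF SE TE !(mevalM (v ord0) (mon _ _)) !mon_at !expr0 mulr1 mul1r -/s -/t => wF0 uF0.
  case/orP: st => h0; first by apply: (mulfI (expf_neq0 (e - al.+1).+1 h0)); rewrite uF0 mulr0.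
  by apply: (mulfI (expf_neq0 al.+2 h0)); rewrite wF0 mulr0.
(* At the ends i = 0 and i = e the common quotient is 0; these two equations are
   the ones that t d/dt and s d/ds contribute. *)
have uw0 i : (i <= e)%N -> (chartS i F).@[v ord0] = 0 /\ (chartT i F).@[v ord0] = 0.
  move=> ie; have [g hg [uF wF]] := chart_gluing ie IF hF.
  suff gv : g.@[v ord0] = 0 by rewrite uF wF !mevalM gv !mulr0.
  have [i0|i0] := posnP i.
    suff -> : g = 0 by rewrite meval0.
    apply: (mulfI (expf_neq0 i.+1 (X2_neq0 ord_max))); rewrite -wF mulr0.
    by rewrite /chartT /pbder big1 // => k _; rewrite i0 sub0n mulr0n.
  have [ie'|ie'] := leqP e i.
    suff -> : g = 0 by rewrite meval0.
    apply: (mulfI (expf_neq0 (e - i).+1 (X2_neq0 ord0))); rewrite -uF mulr0.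
    rewrite /chartS /pbder big1 // => k _; rewrite /chartS_coef; case: leqP => ke;
      last by rewrite mul0r mul0rn.
    by rewrite (_ : k - i = 0)%N ?mulr0n //; lia.
  have iE : i.-1.+1 = i by lia.
  have [uF' _] := low i.-1 ltac:(lia); rewrite iE uF in uF'.
  by rewrite (mulfI (expf_neq0 (e - i).+1 (X2_neq0 ord0)) uF') f0 // /conormal_rank; lia.
have e0 : \sum_(k < e.+1) s ^+ (e - k) * t ^+ k * D k = 0.
  have := congr1 (meval (v ord0)) (logder_const_weight 1 IF hF); rewrite meval0.
  have -> : logder (fun=> 1%N) F = pbder (fun k :
    'I_n.+1 => (if (k <= e)%N then mon (e - k) k else 0)) (fun=> 1%N) F.
    by apply: eq_bigr => k _; rewrite tnth_rnc.
  rewrite (pbder_at (x := fun k => if (k <= e)%N then mon (e - k) k else 0)) => [|k ke];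
    last by rewrite leqNgt ke.
  move=> E; rewrite -[RHS]E; apply: eq_bigr => k _; by rewrite mulr1n -ltnS ltn_ord mon_at.
have Dlow k : (k <= e)%N -> D k = 0.
  case/orP: st => h0.
    apply: (chart_system_inj h0 (D := D) (t := t)) => // i ie.
    by rewrite -uE; apply: (proj1 (uw0 i _)); lia.
  move=> ke; rewrite -(subKn ke).
  apply: (chart_system_inj h0 (D := fun k => D (e - k)%N) (t := s)); last by lia.
    move=> i ie; have [_] := uw0 (e - i)%N ltac:(lia); rewrite wE => E; rewrite -[RHS]E.
    rewrite (reindex_inj rev_ord_inj); apply: eq_bigr => x _ /=; have := ltn_ord x => hx.
    rewrite subSS (subKn (hx : (x <= e)%N)) [t ^+ _ * _]mulrC.
    by congr (_ ^+ _ * _ * _ *+ _); lia.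
  rewrite -[RHS]e0 (reindex_inj rev_ord_inj); apply: eq_bigr => x _ /=; have := ltn_ord x => hx.
  by rewrite subSS (subKn (hx : (x <= e)%N)) [t ^+ _ * _]mulrC.
split=> [|k]; first exact: IF.
rewrite -pullback_at -[k]inord_val -/(D k).
have [ke|ke] := leqP k e; first exact: Dlow.
have hk := ltn_ord k; have kE : (k - 2).+2 = k by lia.
rewrite /D -{1}kE -high ?f0 //; rewrite /conormal_rank; lia.
Qed.

(** * Splitting the normal sheaf *)

Lemma twist_at_form (k : int) v f : v != 0 -> form k f -> twist_at k v (FF f).
Proof.
move=> v0 hf; have [->|f0] := eqVneq f 0; first by rewrite tofrac0; apply: twist_at0.
have [i -> hi] := form_neq0 hf f0; exists i, 0%N, f, 1.
by split; rewrite ?dhomog1 ?meval1 ?oner_neq0 ?addr0 // FF1 divr1.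
Qed.

Lemma twist_atD (k : int) v (x y : Kst K) : v != 0 ->
  twist_at k v x -> twist_at k v y -> twist_at k v (x + y).
Proof.
move=> v0 hx hy; rewrite -[x]mul1r; apply: twist_at_lin => //.
by have := twist_at_form v0 (form1 K); rewrite FF1.
Qed.

Lemma twist_atM (k l : int) v (x y : Kst K) :
  twist_at k v x -> twist_at l v y -> twist_at (k + l) v (x * y).
Proof.
move=> [i0 [j0 [a0 [b0 [ha0 hb0 e0 n0 ->]]]]] [i1 [j1 [a1 [b1 [ha1 hb1 e1 n1 ->]]]]].
exists (i0 + i1)%N, (j0 + j1)%N, (a0 * a1), (b0 * b1); split.
- exact: dhomogM.
- exact: dhomogM.
- by rewrite !PoszD e0 e1; lia.
- by rewrite mevalM mulf_neq0.
- by rewrite mulf_div !FFM.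
Qed.

Lemma twist_at_div (k l : int) v (x : Kst K) g :
  form l g -> g.@[v ord0] != 0 -> twist_at k v x -> twist_at (k - l) v (x / FF g).
Proof.
move=> hg gv hx; apply: twist_atM => //.
have g0 : g != 0 by apply: contraNneq gv => ->; rewrite meval0.
have [j -> hj] := form_neq0 hg g0; exists 0%N, j, 1, g.
by split; rewrite ?dhomog1 ?addNr ?FF1 ?mul1r.
Qed.

Lemma twist_at_sum (J : Type) (s : seq J) (Q : pred J) (f : J -> Kst K) (k : int) v : v != 0 ->
  (forall j, Q j -> twist_at k v (f j)) -> twist_at k v (\sum_(j <- s | Q j) f j).
Proof.
move=> v0 h; elim/big_ind: _ => //; first exact: twist_at0.
by move=> x y; apply: twist_atD.
Qed.

Lemma normal_degree_le al : normal_degree al <= e%:Z * 3.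
Proof. by rewrite /normal_degree; case: ifP => _; lia. Qed.

Lemma point_coord_neq0 v : v != 0 -> (v ord0 ord0 != 0) \/ (v ord0 ord_max != 0).
Proof.
case/rV0Pn => j; case: (unliftP ord0 j) => [j'|] -> h; [right|by left].
by rewrite (_ : ord_max = lift ord0 j') //; apply: val_inj; rewrite /= (ord1 j').
Qed.

(** psi is evaluated on cubics lifting s^D e_al and t^D e_al; at every point one
of these monomials is a unit. *)
Lemma normal_coord_twist F U psi al : (al < conormal_rank)%N -> normal_sections e F U psi ->
  twist (normal_degree al) U (normal_coord psi al).
Proof.
move=> alr [lin tw _ _] v Uv; have v0 : v != 0 by case: Uv.
have le := normal_degree_le al; set D := absz (e%:Z * 3 - normal_degree al)%R.
have [x [y [xy mv]]] : exists x y : nat, (x + y)%N = D /\ (mon x y).@[v ord0] != 0.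
  have [h|h] := point_coord_neq0 v0.
    by exists D, 0%N; rewrite addn0 mon_at expr0 mulr1 expf_neq0.
  by exists 0%N, D; rewrite mon_at expr0 mul1r expf_neq0.
have [|p [Ip hp pE]] := @conormal_lift 3 al x y isT alr; first by rewrite xy /D; lia.
have psiE : psi p = normal_coord psi al * FF (mon x y).
  rewrite (conormal_expansion lin Ip) (bigD1 (Ordinal alr)) //= big1 ?addr0 => [|be ne].
    by rewrite pE // eqxx mulr1n.
  by rewrite pE // (_ : (_ == _) = false) ?mulr0n ?FF0 ?mulr0 //; apply: negbTE.
have -> : normal_coord psi al = psi p / FF (mon x y).
  by rewrite psiE mulfK // tofrac_neq0 // mon_neq0.
rewrite (_ : normal_degree al = (e * 3)%N%:Z - (x + y)%N%:Z); last by rewrite xy /D; lia.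
by apply: twist_at_div; [exact: form_mon|exact: mv|exact: tw].
Qed.

Definition of_coords m (c : 'rV[Kst K]_m) : P -> (Kst K)^o :=
  fun p => if `[<I p>] then \sum_j c 0 j * conormal j p else 0.

Lemma of_coordsE m (c : 'rV[Kst K]_m) p :
  I p -> of_coords c p = \sum_j c 0 j * conormal j p.
Proof. by move=> Ip; rewrite /of_coords; case: asboolP. Qed.

Lemma normal_coord_of_coords m (c : 'rV[Kst K]_m) (j : 'I_m) : m = conormal_rank ->
  normal_coord (of_coords c) j = c 0 j.
Proof.
move=> mE; have jr : (j < conormal_rank)%N by rewrite -mE.
rewrite /normal_coord; case: ltnP => je.
  have Iq : I (quadric j.+1) by apply: ideal_quadric; lia.
  rewrite of_coordsE // (bigD1 j) //= big1 ?addr0 => [|l /negPf lj].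
    rewrite conormal_quadric ?eqxx ?mulr1n ?mulfK //; last by lia.
    by rewrite tofrac_neq0 // mon_neq0.
  rewrite conormal_quadric ?eqSS ?val_eqE ?lj ?mulr0n ?FF0 ?mulr0 -?mE //; lia.
have hv : (e < j.+2 <= n)%N by move: jr; rewrite /conormal_rank; lia.
have Iv := ideal_var hv; rewrite of_coordsE // (bigD1 j) //= big1 ?addr0 => [|l /negPf lj].
  by rewrite conormal_var // eqxx FF1 mulr1.
by rewrite conormal_var ?eqSS ?val_eqE ?lj ?FF0 ?mulr0 -?mE.
Qed.

Lemma of_coords_sections F U m (c : 'rV[Kst K]_m) : I F -> m = conormal_rank ->
  (forall j : 'I_m, twist (normal_degree j) U (c 0 j)) ->
  \sum_j c 0 j * conormal j F = 0 -> normal_sections e F U (of_coords c).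
Proof.
move=> IF mE hc cF; split=> [a p q Ip Iq|k p Ip hp v Uv||p Ip].
- rewrite !of_coordsE //; last by apply: idealD => //; apply: idealM.
  rewrite mulr_sumr -big_split; apply: eq_bigr => j _ /=.
  by rewrite conormal_lin // mulrDr mulrCA.
- have v0 : v != 0 by case: Uv.
  rewrite of_coordsE //; apply: twist_at_sum => // j _.
  have [|f hf ->] := @conormal_form j k p _ Ip hp; first by rewrite -mE.
  rewrite (_ : (e * k)%N%:Z = normal_degree j + (e%:Z * k%:Z - normal_degree j)); last by lia.
  by apply: twist_atM; [apply: hc|apply: twist_at_form].
- by rewrite of_coordsE.
- by rewrite /of_coords; case: asboolP.
Qed.

Lemma form_adj r (N k : 'I_r -> int) (B : 'M[R]_r) (x i : 'I_r) :
  (forall a b : 'I_r, form (N b - k a) (B a b)) ->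
  form (\sum_x N x - \sum_i k i - N x + k i) ((\adj B) x i).
Proof.
case: r N k B x i => [|r] N k B x i hB; first by case: x.
rewrite mxE /cofactor (bigD1_ord x) //= [\sum_i k i](bigD1_ord i) //=.
rewrite [X in form X _](_ : _ = 0 + (\sum_(j < r) N (lift x j) - \sum_(j < r) k (lift i j))).
  2: by move: (\sum_(j < r) N _) (\sum_(j < r) k _) => s1 s2; lia.
apply: formM.
  by rewrite -signr_odd; case: (odd _); rewrite ?expr0 ?expr1 ?formN // form1.
by apply: form_det => a b; rewrite !mxE; apply: hB.
Qed.

(** The isomorphism sends y to the map with coordinates y A. Over K(s,t) the rows
of A span the kernel of G for reasons of rank. At each point Cramer's rule with a
maximal minor that is nonzero there shows that y is regular when y A is. *)
Lemma normal_sheaf_split F m r (ks : seq int) (G : 'cV[R]_m) (A : 'M[R]_(r, m)) (k : 'I_r -> int) :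
  I F -> r.+1 = m -> m = conormal_rank -> size ks = r -> (forall i : 'I_r, k i = ks`_i) ->
  (forall j : 'I_m, conormal j F = FF (G j 0)) -> G != 0 ->
  kernel_basis (fun j : 'I_m => normal_degree j) k G A ->
  sheaf_iso (normal_sheaf e F) (line_sum K ks).
Proof.
move=> IF rm mE rE; subst r; subst m => kE GE G0 [hA AG fA].
have {}hA (i : 'I_(size ks)) (j : 'I_(size ks).+1) :
  form (normal_degree j - ks`_i) (A i j) by rewrite -kE.
pose tf : {rmorphism R -> Kst K} := @FracField.tofrac R.
pose AL : 'M[Kst K]_(size ks, (size ks).+1) := map_mx tf A.
pose GL : 'cV[Kst K]_(size ks).+1 := map_mx tf G.
have minor v : v != 0 -> exists j, (\det (col' j A)).@[v ord0] != 0.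
  move=> v0; have [j dj] := row_free_minor (fA v v0); exists j.
  by rewrite -det_at (_ : mx_at v (col' j A) = col' j (mx_at v A)) //; apply/matrixP => a b;
    rewrite !mxE.
have fAL : row_free AL.
  have [v v0] := ex_point K; have [j dj] := minor v v0.
  apply: (@minor_row_free _ _ _ _ (lift j)).
  rewrite -col'_colsub /AL -map_col' det_map_mx tofrac_neq0 //.
  by apply: contraNneq dj => ->; rewrite meval0.
have GL0 : GL != 0.
  apply: contraNneq G0 => GL0; apply/eqP/matrixP => a c; rewrite [RHS]mxE; apply/eqP;
    rewrite -tofrac_eq0.
  by have := congr1 (fun M : 'cV_(size ks).+1 => M a c) GL0; rewrite !mxE => ->.
have ALG : AL *m GL = 0 by rewrite -map_mxM AG map_mx0.
have inAL c : c *m GL = 0 -> (c <= AL)%MS.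
  move=> cG; apply: submx_trans (_ : (kermx GL <= AL)%MS); first by apply/sub_kermxP.
  have sAk : (AL <= kermx GL)%MS by apply/sub_kermxP.
  rewrite -(mxrank_leqif_sup sAk).2 mxrank_ker (eqP fAL).
  rewrite (_ : \rank GL = 1%N) ?subn1 //; apply/eqP;
    rewrite eqn_leq rank_leq_col lt0n mxrank_eq0 //.
pose cvec (psi : P -> (Kst K)^o) : 'rV[Kst K]_(size ks).+1 := \row_j normal_coord psi j.
have cvecP U psi : normal_sections e F U psi ->
    [/\ forall p, I p -> psi p = of_coords (cvec psi) p, (cvec psi <= AL)%MS
      & forall j : 'I_(size ks).+1, twist (normal_degree j) U (cvec psi 0 j)].
  move=> hpsi; have [lin tw psiF _] := hpsi.
  have E p : I p -> psi p = of_coords (cvec psi) p.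
    move=> Ip; rewrite of_coordsE // (conormal_expansion lin Ip) -mE.
    by apply: eq_bigr => j _; rewrite mxE.
  split=> //.
    apply: inAL; apply/matrixP => a b; rewrite !mxE (ord1 a) (ord1 b).
    rewrite -[RHS]psiF E // of_coordsE //; apply: eq_bigr => j _.
    by rewrite GE !mxE.
  by move=> j; rewrite mxE; apply: normal_coord_twist hpsi => //; rewrite -mE.
have regular U (y : 'rV[Kst K]_(size ks)) :
    (forall j : 'I_(size ks).+1, twist (normal_degree j) U ((y *m AL) 0 j)) ->
    line_sum_sections U y.
  move=> hy i v Uv; have v0 : v != 0 by case: Uv.
  have [j dj] := minor v v0; set B := col' j A in dj.
  have dB : \det B != 0 by apply: contraNneq dj => ->; rewrite meval0.
  have hB (a b : 'I_(size ks)) : form (normal_degree (lift j b) - ks`_a) (B a b) by rewrite mxE; apply: hA.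
  have hdet := form_det hB.
  have yE : y 0 i = (\sum_x (y *m AL) 0 (lift j x) * tf ((\adj B) x i)) / tf (\det B).
    apply: (canRL (mulfK _)); first by rewrite tofrac_neq0.
    have : y *m col' j AL *m \adj (col' j AL) = (tf (\det B)) *: y.
      by rewrite -mulmxA mul_mx_adj -map_col' det_map_mx mul_mx_scalar.
    move/(congr1 (fun M : 'rV_(size ks) => M 0 i)); rewrite mxE [in RHS]mxE mulrC => <-.
    apply: eq_bigr => x _; congr (_ * _).
      by rewrite !mxE; apply: eq_bigr => z _; rewrite !mxE.
    by rewrite -map_col' -map_mx_adj mxE.
  rewrite yE; set mu := (X in form X (\det B)) in hdet.
  rewrite (_ : ks`_i = mu + ks`_i - mu); last by lia.
  apply: twist_at_div => //; apply: twist_at_sum => // x _.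
  rewrite (_ : mu + ks`_i = normal_degree (lift j x) + (mu - normal_degree (lift j x) + ks`_i)); last by lia.
  apply: twist_atM; first exact: hy.
  by apply: twist_at_form => //; apply: (form_adj x i hB).
exists (fun _ psi => cvec psi *m pinvmx AL), (fun _ y => of_coords (y *m AL)); split.
- move=> U psi hpsi; have [E sub tw] := cvecP U psi hpsi; have [_ _ _ psi0] := hpsi.
  have cE : cvec psi *m pinvmx AL *m AL = cvec psi by rewrite mulmxKpV.
  split; first by apply: regular => j; rewrite cE.
  apply: funext => p; rewrite cE; have [Ip|Ip] := pselect (I p); first by rewrite -E.
  by rewrite psi0 // /of_coords; case: asboolP.
- move=> U y hy; split.
    apply: of_coords_sections => // [j v Uv|].
      have v0 : v != 0 by case: Uv.
      rewrite mxE; apply: twist_at_sum => // i _.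
      rewrite (_ : normal_degree j = ks`_i + (normal_degree j - ks`_i)); last by lia.
      by apply: twist_atM; [apply: hy|rewrite mxE; apply: twist_at_form].
    have : (y *m AL *m GL) 0 0 = 0 by rewrite -mulmxA ALG mulmx0 mxE.
    rewrite mxE => H; rewrite -[RHS]H; apply: eq_bigr => j _.
    by rewrite GE [GL _ _]mxE.
  rewrite (_ : cvec _ = y *m AL); first by rewrite mulmxKp.
  by apply/rowP => j; rewrite mxE normal_coord_of_coords.
- move=> U c x y _ _ _; rewrite scalemxAl -mulmxDl; congr (_ *m _).
  apply/rowP => j; rewrite !mxE /normal_coord; case: ifP => _ //.
  have -> p : (c *: x + y) p = c * x p + y p by [].
  by rewrite mulrDl mulrA.
- by [].
Qed.

(** * Explicit kernels and their hypersurfaces *)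

Lemma row_free_rowsub (L : fieldType) (a r m : nat) (h : 'I_a -> 'I_r) (A : 'M[L]_(r, m)) :
  injective h -> row_free A -> row_free (rowsub h A).
Proof.
move=> hinj /row_freeP[B AB]; apply/row_freeP; exists (B *m (rowsub h 1%:M)^T).
rewrite mulmxA mul_rowsub_mx AB; apply/matrixP => x y.
rewrite !mxE (bigD1 (h x)) //= big1 => [|z /negPf zx].
  by rewrite !mxE eqxx mul1r addr0 eq_sym (inj_eq hinj) eq_sym.
by rewrite !mxE eq_sym zx mul0r.
Qed.

Lemma kernel_basis_rowsub m r l (N : 'I_m -> int) (k : 'I_r -> int) (G : 'cV[R]_m)
    (A : 'M[R]_(r, m)) (h : 'I_l -> 'I_r) : injective h ->
  kernel_basis N k G A -> kernel_basis N (k \o h) G (rowsub h A).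
Proof.
move=> hinj [hA AG fA]; split=> [i j||v v0]; first by rewrite mxE; apply: hA.
  by rewrite mul_rowsub_mx AG; apply/matrixP => x y; rewrite !mxE.
rewrite (_ : mx_at v _ = rowsub h (mx_at v A)); last by apply/matrixP => x y; rewrite !mxE.
by apply: row_free_rowsub => //; apply: fA.
Qed.

(** Lets the classification list the degrees above e first. *)
Lemma kernel_basis_seq m r (N : 'I_m -> int) (k : 'I_r -> int) (G : 'cV[R]_m)
    (A : 'M[R]_(r, m)) (ks : seq int) : kernel_basis N k G A ->
  perm_eq ks (map k (enum 'I_r)) ->
  exists A' : 'M[R]_(r, m), kernel_basis N (fun i : 'I_r => ks`_i) G A'.
Proof.
move=> kb pe; have sz : size ks == r by rewrite (perm_size pe) size_map size_enum_ord.
have : perm_eq (Tuple sz) [tuple k z | z < r] by exact: pe.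
case/tuple_permP => s E; exists (rowsub s A).
have := kernel_basis_rowsub (@perm_inj _ s) kb; case=> h1 h2 h3; split=> // i j.
have -> : ks`_i = k (s i); last exact: h1.
have -> : ks = [tuple tnth [tuple k z | z < r] (s z) | z < r] by exact: E.
by rewrite -(tnth_nth 0 _ i) !tnth_mktuple.
Qed.

Lemma kernel_basis_ex m (N : 'I_m -> int) (G : 'cV[R]_m) (D : int) :
  (forall j, form (D - N j) (G j 0)) -> nowhere_zero G ->
  exists r (k : 'I_r -> int) (A : 'M[R]_(r, m)),
    [/\ r.+1 = m, kernel_basis N k G A & \sum_i k i = \sum_j N j - D].
Proof.
case: m N G => [|r] N G hG nG.
  by have [v v0] := ex_point K; have [[]] := mx_at_neq0P (nG v v0).
have [k [A kb]] := kernel_basis_exists hG nG; exists r, k, A; split=> //.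
exact: kernel_basis_deg hG nG _ _ kb.
Qed.

Lemma kernel_basis_block m1 m2 r (N : 'I_(m1 + m2) -> int) (k : 'I_(m1 + r) -> int)
    (G : 'cV[R]_m2) (A : 'M[R]_(r, m2)) :
  (forall z, N (lshift m2 z) = k (lshift r z)) ->
  (forall z z', N (lshift m2 z) = N (lshift m2 z')) ->
  kernel_basis (fun z => N (rshift m1 z)) (fun z => k (rshift m1 z)) G A ->
  kernel_basis N k (col_mx 0 G) (block_mx 1%:M 0 0 A).
Proof.
move=> Nk NN [hA AG fA]; split=> [i j||v v0].
- case: (split_ordP i) => i' ->; case: (split_ordP j) => j' ->.
  + rewrite block_mxEul mxE -Nk (NN j' i') subrr.
    by case: eqP => _; rewrite ?mulr1n ?mulr0n ?form0 ?form1.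
  + by rewrite block_mxEur mxE form0.
  + by rewrite block_mxEdl mxE form0.
  + by rewrite block_mxEdr; apply: hA.
- by rewrite mul_block_col !mul0mx mulmx0 AG !addr0 col_mx0.
- rewrite /mx_at map_block_mx map_scalar_mx !map_mx0 rmorph1 /=.
  apply: inj_row_free => y; rewrite -[y]hsubmxK mul_row_block !mulmx0 mulmx1 add0r addr0.
  rewrite -(@row_mx0 _ 1 m1 m2) => /eq_row_mx[-> E].
  rewrite (_ : rsubmx y = 0) ?row_mx0 //; apply: (row_free_inj (fA v v0)).
  by rewrite mul0mx.
Qed.

(** The maximal minors of a bidiagonal matrix are monomials: deleting column j
leaves the diagonal entries before j and the entries next to the diagonal from
j on. One of the first and last minors is nonzero at every point. *)
Lemma bidiagonal_basis m r (N k : nat -> int) : r.+1 = m ->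
  (forall i, (i < r)%N -> k i <= N i /\ k i <= N i.+1) ->
  exists (x y : nat -> nat) (c : nat -> K) (A : 'M[R]_(r, m)),
    let G : 'cV[R]_m := \col_(j < m) (c j *: mon (x j) (y j)) in
    [/\ forall j, (j < m)%N -> (x j + y j)%N%:Z + N j = \sum_(i < m) N i - \sum_(i < r) k i,
        nowhere_zero G & kernel_basis (fun j : 'I_m => N j) (fun i : 'I_r => k i) G A].
Proof.
move=> <- {m} le.
pose p i := absz (N i - k i)%R; pose q i := absz (N i.+1 - k i)%R.
pose x j := (\sum_(0 <= i < j) p i)%N; pose y j := (\sum_(j <= i < r) q i)%N.
pose c j : K := (-1) ^+ j.
pose A : 'M[R]_(r, r.+1) := \matrix_(i, j)
  if j == i :> nat then S ^+ p i else if j == i.+1 :> nat then T ^+ q i else 0.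
have A0 (i : 'I_r) (j : 'I_r.+1) : j = i :> nat -> A i j = S ^+ p i.
  by move=> E; rewrite mxE E eqxx.
have A1 (i : 'I_r) (j : 'I_r.+1) : j = i.+1 :> nat -> A i j = T ^+ q i.
  by move=> E; rewrite mxE E (_ : (_ == _) = false) ?eqxx //; lia.
have A2 (i : 'I_r) (j : 'I_r.+1) : j != i :> nat -> j != i.+1 :> nat -> A i j = 0.
  by move=> /negPf E1 /negPf E2; rewrite mxE E1 E2.
clearbody A; exists x, y, c, A => G.
have GE (j : 'I_r.+1) : G j 0 = c j *: mon (x j) (y j) by rewrite mxE.
have c0 j : c j != 0 by rewrite signr_eq0.
split.
- move=> j jr; rewrite PoszD /x /y.
  have -> : \sum_(i < r) k i = \sum_(0 <= i < j) k i + \sum_(j <= i < r) k i.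
    by rewrite -(big_mkord xpredT) (big_cat_nat (n := j)) //; lia.
  have -> : \sum_(i < r.+1) N i = \sum_(0 <= i < j) N i + N j + \sum_(j <= i < r) N i.+1.
    by rewrite -(big_mkord xpredT N) (big_cat_nat (leq0n j) (ltnW jr)) /=
      (big_ltn jr) big_add1 addrA.
  rewrite !(big_morph Posz PoszD (erefl _)).
  have -> : \sum_(0 <= i < j) (p i)%:Z = \sum_(0 <= i < j) N i - \sum_(0 <= i < j) k i.
    rewrite -sumrB; apply: eq_big_nat => i ij.
    by have [|h _] := le i; rewrite /p; lia.
  have -> : \sum_(j <= i < r) (q i)%:Z = \sum_(j <= i < r) N i.+1 - \sum_(j <= i < r) k i.
    rewrite -sumrB; apply: eq_big_nat => i ij.
    by have [|_ h] := le i; rewrite /q; lia.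
  by ring.
- move=> v v0; case: (point_coord_neq0 v0) => h.
    apply: (@mx_at_neq0 _ _ _ v _ ord_max ord0).
    by rewrite GE mevalZ mon_at /= /y big_geq // expr0 mulr1 mulf_neq0 // expf_neq0.
  apply: (@mx_at_neq0 _ _ _ v _ ord0 ord0).
  by rewrite GE mevalZ mon_at /= /x big_geq // expr0 mul1r mulf_neq0 // expf_neq0.
- split.
  + move=> i j; have [l1 l2] := le i (ltn_ord i).
    have [E|E] := eqVneq (j : nat) i.
      rewrite A0 // E (_ : _ - _ = 1 * (p i)%:Z); last by rewrite /p; lia.
      by apply/formXn/formX.
    have [E1|E1] := eqVneq (j : nat) i.+1; last by rewrite A2 // form0.
    rewrite A1 // E1 (_ : _ - _ = 1 * (q i)%:Z); last by rewrite /q; lia.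
    by apply/formXn/formX.
  + apply/matrixP => i a; rewrite !mxE (ord1 a).
    have ir := ltn_ord i; have i0 : (i < r.+1)%N by lia.
    have i1 : (i.+1 < r.+1)%N by lia.
    rewrite (bigD1 (Ordinal i0)) //= (bigD1 (Ordinal i1)) /=; last by rewrite -val_eqE /=; lia.
    rewrite big1 => [|j /andP[]]; last first.
      by rewrite -!val_eqE /= => j0 j1; rewrite A2 ?mul0r.
    rewrite A0 // A1 // !GE addr0 /= /c exprS mulN1r scaleNr mulrN -!scalerAr SE TE !monM !add0n.
    have -> : (p i + x i)%N = x i.+1 by rewrite /x big_nat_recr //= addnC.
    by have -> : (q i + y i.+1)%N = y i; [rewrite /y [in RHS]big_ltn|rewrite subrr].
  + move=> v v0; case: (point_coord_neq0 v0) => h.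
      apply: (@minor_row_free _ _ _ _ (lift ord_max)); rewrite -det_tr det_trig.
        rewrite prodf_seq_neq0; apply/allP => i _ /=.
        rewrite !mxE A0 ?lift_max // rmorphXn /= mevalXU expf_neq0 //.
      apply/is_trig_mxP => i j ij; rewrite !mxE A2 ?meval0 // lift_max.
        by rewrite neq_ltn ij.
      by rewrite neq_ltn ltnS (ltnW ij).
    apply: (@minor_row_free _ _ _ _ (lift ord0)); rewrite det_trig.
      rewrite prodf_seq_neq0; apply/allP => i _ /=.
      rewrite !mxE A1 ?lift0 // rmorphXn /= mevalXU expf_neq0 //.
    apply/is_trig_mxP => i j ij; rewrite !mxE A2 ?meval0 // lift0.
      by rewrite neq_ltn ltnS (ltnW ij) orbT.
    by rewrite eqSS neq_ltn ij orbT.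
Qed.

Lemma conormal_realize d (x y : nat -> nat) (c : nat -> K) : (3 <= d)%N ->
  (forall al, (al < conormal_rank)%N -> (x al + y al)%N%:Z + normal_degree al = e%:Z * d%:Z) ->
  exists F, [/\ I F, F \is d.-homog &
    forall al, (al < conormal_rank)%N -> conormal al F = FF (c al *: mon (x al) (y al))].
Proof.
move=> hd hxy.
suff H : forall l, (l <= conormal_rank)%N -> exists F, [/\ I F, F \is d.-homog &
    forall al, (al < conormal_rank)%N -> conormal al F =
      if (al < l)%N then FF (c al *: mon (x al) (y al)) else 0].
  by have [F [IF hF E]] := H conormal_rank (leqnn _); exists F; split=> // al alr; rewrite E // alr.
elim=> [|l IH] lr.
  by exists 0; split=> [||al _]; [exact: ideal0|exact: dhomog0|rewrite conormal0].
have [F [IF hF E]] := IH (ltnW lr); have [p [Ip hp pE]] := conormal_lift hd lr (hxy l lr).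
exists ((c l)%:MP * p + F); split.
- by apply: idealD => //; apply: idealM.
- by rewrite mul_mpolyC; apply: rpredD => //; apply: rpredZ.
- move=> al alr; rewrite conormal_lin // E // pE // /pullback comp_mpolyC -FFM mul_mpolyC ltnS.
  have [->|ne] := eqVneq al l; first by rewrite leqnn ltnn mulr1n addr0.
  by rewrite mulr0n scaler0 FF0 add0r [in RHS]leq_eqVlt (negPf ne).
Qed.

Lemma nowhere_zero_neq0 m (G : 'cV[R]_m) : nowhere_zero G -> G != 0.
Proof.
move=> nG; have [v v0] := ex_point K; apply: contraNneq (nG v v0) => ->.
by rewrite /mx_at map_mx0.
Qed.

Lemma realize_split d m r (x y : nat -> nat) (c : nat -> K) (ks : seq int)
    (A : 'M[R]_(r, m)) (k : 'I_r -> int) : (3 <= d)%N ->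
  (forall al, (al < conormal_rank)%N -> (x al + y al)%N%:Z + normal_degree al = e%:Z * d%:Z) ->
  r.+1 = m -> m = conormal_rank -> size ks = r -> (forall i : 'I_r, k i = ks`_i) ->
  let G : 'cV[R]_m := \col_(j < m) (c j *: mon (x j) (y j)) in
  nowhere_zero G -> kernel_basis (fun j : 'I_m => normal_degree j) k G A ->
  exists F : P, hypersurface_smooth_along_rnc e d F /\
    sheaf_iso (normal_sheaf e F) (line_sum K ks).
Proof.
move=> hd hxy rm mE sz kE G nG kb.
have [F [IF hF FE]] := conormal_realize c hd hxy.
have GE (j : 'I_m) : conormal j F = FF (G j 0) by rewrite mxE FE // -mE.
have G0 := nowhere_zero_neq0 nG.
exists F; split; last exact: (normal_sheaf_split IF rm mE sz kE GE G0 kb).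
split=> //.
  apply: contraNneq G0 => F0; apply/eqP/matrixP => j a; rewrite (ord1 a) [RHS]mxE.
  by apply/eqP; rewrite -tofrac_eq0 -GE F0 conormal0.
move=> v v0 /(singular_on_rncP IF hF v0 FE) H.
have [j [a]] := mx_at_neq0P (nG v v0); rewrite (ord1 a) mxE H ?eqxx // -mE //.
Qed.

(** * The bundles E and E', and the classification *)

Lemma kernel_basis_eq m r (N N' : 'I_m -> int) (k k' : 'I_r -> int)
    (G : 'cV[R]_m) (A : 'M[R]_(r, m)) :
  N =1 N' -> k =1 k' -> kernel_basis N k G A -> kernel_basis N' k' G A.
Proof. by move=> NN kk [h1 h2 h3]; split=> // z z'; rewrite -NN -kk. Qed.

Lemma sum_map_sub (c : int) (s : seq nat) :
  \sum_(x <- [seq c - z%:Z | z <- s]) x = c * (size s)%:Z - (\sum_(z <- s) z)%N%:Z.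
Proof.
elim: s => [|z s IH]; first by rewrite !big_nil mulr0 subr0.
by rewrite /= !big_cons IH; move: (\sum_(z <- s) z)%N => t; rewrite intS; lia.
Qed.

Lemma sum_const_int (l : nat) (x : int) : \sum_(z < l) x = l%:Z * x.
Proof. by rewrite sumr_const card_ord -[LHS]mulr_natl natz. Qed.

Lemma sum_nth (s : seq int) r : size s = r -> \sum_(z < r) s`_z = \sum_(x <- s) x.
Proof. by move=> <-; rewrite [RHS](big_nth 0) big_mkord. Qed.

Lemma sum_normal_degree : \sum_(j < conormal_rank) normal_degree j =
  e.-1%:Z * (e%:Z + 2) + (n - e)%N%:Z * e%:Z.
Proof.
rewrite big_split_ord /=; congr (_ + _).
  rewrite (eq_bigr (fun=> e%:Z + 2)) => [|j _]; last by rewrite /normal_degree ltn_ord.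
  exact: sum_const_int.
rewrite (eq_bigr (fun=> e%:Z)) => [|j _]; last by rewrite /normal_degree /= ltnNge leq_addr.
exact: sum_const_int.
Qed.

Lemma normal_degree_ge al : e%:Z <= normal_degree al.
Proof. by rewrite /normal_degree; case: ifP => _; lia. Qed.

Lemma degree_split d : (3 <= d)%N -> (e * (d - 1) + e = e * d)%N.
Proof. by move=> hd; rewrite -[X in (_ + X)%N]muln1 -mulnDr subnK //; lia. Qed.

Lemma degree_bound d : (3 <= d)%N -> (e * 2 <= e * (d - 1))%N.
Proof. by move=> hd; rewrite leq_mul2l; lia. Qed.

Lemma bundle_E_realized d (a : (e - 2).-tuple nat) (b : (n - e).-tuple nat) : (3 <= d)%N ->
  (\sum_(ai <- a) ai + \sum_(bj <- b) bj)%N = (e * (d - 1) - 2)%N ->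
  exists F : P, hypersurface_smooth_along_rnc e d F /\
    sheaf_iso (normal_sheaf e F) (bundle_E K e a b).
Proof.
move=> hd sumab; rewrite /bundle_E; set ks := (_ ++ _).
set r := (e - 2 + (n - e))%N.
have sz : size ks = r by rewrite size_cat !size_map !size_tuple.
have rE : r.+1 = conormal_rank by rewrite /r /conormal_rank; lia.
have le z : (z < r)%N -> ks`_z <= normal_degree z /\ ks`_z <= normal_degree z.+1.
  move=> zr; rewrite /ks nth_cat size_map size_tuple; case: ltnP => ze.
    rewrite (nth_map 0%N) ?size_tuple // /normal_degree (_ : (z < e.-1)%N); last by lia.
    by rewrite (_ : (z.+1 < e.-1)%N); lia.
  have h1 := normal_degree_ge z; have h2 := normal_degree_ge z.+1.
  by rewrite (nth_map 0%N) ?size_tuple; [lia|rewrite /r in zr; lia].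
have [x [y [c [A]]]] := bidiagonal_basis rE le.
rewrite sum_normal_degree (sum_nth sz) /ks big_cat /= !sum_map_sub !size_tuple => -[xy nG kb].
apply: (realize_split (x := x) (y := y) hd _ rE erefl sz (fun _ => erefl) nG kb) => al alr.
rewrite xy // (_ : e.-1%:Z = (e - 2)%N%:Z + 1); last by lia.
rewrite -[in RHS]PoszM -degree_split //; move: sumab (degree_bound hd).
move: (\sum_(ai <- a) ai)%N (\sum_(bj <- b) bj)%N (e * (d - 1))%N => s1 s2 f fE fb.
rewrite (_ : _ - _ = e%:Z + 2 + s1%:Z + s2%:Z); first by lia.
by ring.
Qed.

Lemma nowhere_zero_block m1 m2 (G : 'cV[R]_m2) :
  nowhere_zero G -> nowhere_zero (col_mx (0 : 'cV_m1) G).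
Proof.
move=> nG v v0; have [j [l]] := mx_at_neq0P (nG v v0) => h.
by apply: (@mx_at_neq0 _ _ _ v _ (rshift m1 j) l); rewrite col_mxEd.
Qed.

Lemma nth_E' (b : seq nat) (z : nat) :
  (nseq (e - 1) (e%:Z + 2) ++ [seq e%:Z - bj%:Z | bj <- b])`_z =
  if (z < e - 1)%N then e%:Z + 2 else [seq e%:Z - bj%:Z | bj <- b]`_(z - (e - 1)).
Proof. by rewrite nth_cat size_nseq; case: ifP => // h; rewrite nth_nseq h. Qed.

Lemma kernel_basis_E' (b : (n - e - 1).-tuple nat) (G : 'cV[R]_(n - e))
    (A : 'M[R]_(n - e - 1, n - e)) :
  kernel_basis (fun=> e%:Z) (fun z : 'I_(n - e - 1) => e%:Z - (b`_z)%R%:Z) G A ->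
  kernel_basis (fun j : 'I_conormal_rank => normal_degree j)
   (fun z : 'I_(e.-1 + (n - e - 1)) =>
      (nseq (e - 1) (e%:Z + 2) ++ [seq e%:Z - bj%:Z | bj <- b])`_z)
    (col_mx (0 : 'cV_e.-1) G) (block_mx 1%:M 0 0 A).
Proof.
move=> kb; apply: kernel_basis_block => [z|z z'|].
- by rewrite nth_E' /normal_degree /= ltn_ord (_ : (z < e - 1)%N) // subn1.
- by rewrite /normal_degree /= !ltn_ord.
- apply: kernel_basis_eq kb => z; first by rewrite /normal_degree /= ltnNge leq_addr.
  rewrite nth_E' /= (_ : (e.-1 + z < e - 1)%N = false); last by lia.
  rewrite (_ : e.-1 + z - (e - 1) = z)%N; last by lia.
  by rewrite (nth_map 0%N) // size_tuple.
Qed.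

Lemma bundle_E'_realized d (b : (n - e - 1).-tuple nat) : (3 <= d)%N -> (e < n - 1)%N ->
  (\sum_(bj <- b) bj)%N = (e * (d - 1))%N ->
  exists F : P, hypersurface_smooth_along_rnc e d F /\
    sheaf_iso (normal_sheaf e F) (bundle_E' K e b).
Proof.
move=> hd en sumb; rewrite /bundle_E'.
have rE : (n - e - 1).+1 = (n - e)%N by lia.
have [|x [y [c [A [xy nG kb]]]]] :=
  @bidiagonal_basis _ _ (fun=> e%:Z) (fun z => e%:Z - (b`_z)%R%:Z) rE.
  by move=> z _; lia.
have edE := degree_split hd.
have DE : \sum_(z < n - e) e%:Z - \sum_(z < n - e - 1) (e%:Z - (b`_z)%R%:Z) = e%:Z * d%:Z.
  have -> : \sum_(z < n - e - 1) (e%:Z - (b`_z)%R%:Z) = \sum_(u <- [seq e%:Z - z%:Z | z <- b]) u.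
    by rewrite big_map (big_nth 0%N) size_tuple big_mkord.
  rewrite sum_map_sub size_tuple sumb sum_const_int -(PoszM e d) -edE.
  move: (e * (d - 1))%N => f; rewrite PoszD.
  by rewrite (_ : (n - e)%N%:Z = (n - e - 1)%N%:Z + 1); [ring|lia].
pose x' j := if (j < e.-1)%N then (e * d - (e + 2))%N else x (j - e.-1)%N.
pose y' j := if (j < e.-1)%N then 0%N else y (j - e.-1)%N.
pose c' j := if (j < e.-1)%N then 0 else c (j - e.-1)%N.
have GE : \col_(j < conormal_rank) (c' j *: mon (x' j) (y' j)) =
    col_mx (0 : 'cV_e.-1) (\col_(j < n - e) (c j *: mon (x j) (y j))).
  apply/matrixP => j l; rewrite mxE; case: (split_ordP j) => j' ->.
    by rewrite col_mxEu mxE /c' /= ltn_ord scale0r.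
  by rewrite col_mxEd mxE /c' /x' /y' /= ltnNge leq_addr /= addKn.
have := kernel_basis_E' kb; rewrite -GE => kb'.
have nG' : nowhere_zero (\col_(j < conormal_rank) (c' j *: mon (x' j) (y' j))).
  by rewrite GE; apply: nowhere_zero_block.
apply: (realize_split (x := x') (y := y') hd _ _ erefl _ (fun _ => erefl) nG' kb').
- move=> al alr; rewrite /x' /y' /normal_degree; case: ltnP => ale.
    have : (e * 3 <= e * d)%N by rewrite leq_mul.
    rewrite -[in RHS]PoszM; move: (e * d)%N => g; lia.
  by rewrite -DE -(xy (al - e.-1)%N) //; move: alr; rewrite /conormal_rank; lia.
- by rewrite /conormal_rank; lia.
- by rewrite size_cat size_nseq size_map size_tuple; lia.
Qed.

Section Classification.
Variables (d : nat) (F : P).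
Hypothesis hF : hypersurface_smooth_along_rnc e d F.

Lemma conormal_forms : exists G : 'cV[R]_conormal_rank,
  [/\ forall j : 'I_conormal_rank, form (e%:Z * d%:Z - normal_degree j) (G j 0),
      forall j : 'I_conormal_rank, conormal j F = FF (G j 0) & nowhere_zero G].
Proof.
case: hF => F0 hdF IF sm.
have [f hf fE] := fin_all_exists2 (fun j : 'I_conormal_rank => conormal_form (ltn_ord j) IF hdF).
exists (\col_j f j); split=> [j|j|v v0]; rewrite ?mxE //.
apply: contra_not_neq (sm v v0) => Gv.
apply/(@singular_on_rncP F d v (fun al => oapp f 0 (insub al)) IF hdF v0) => al alr.
  by rewrite insubT /= -fE.
rewrite insubT /=; have /matrixP/(_ (Ordinal alr) 0) := Gv.
by rewrite !mxE.
Qed.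

(** A row that is 0 nowhere has a nonzero entry, of nonnegative degree. *)
Lemma row_degree_le m r (N : 'I_m -> int) (k : 'I_r -> int) (G : 'cV[R]_m)
    (A : 'M[R]_(r, m)) (c : int) :
  kernel_basis N k G A -> (forall j, N j <= c) -> forall z, k z <= c.
Proof.
move=> [hA _ fA] Nc z; have [v v0] := ex_point K.
have : row z A != 0.
  apply: contraL (fA v v0) => /eqP rz; apply/negP => /row_freeP[B AB].
  have /matrixP/(_ z z) := AB; rewrite !mxE eqxx big1 => [/eqP|j _].
    by rewrite eq_sym oner_eq0.
  have /rowP/(_ j) := rz; rewrite !mxE => ->; by rewrite meval0 mul0r.
case/rV0Pn => j; rewrite mxE => Azj.
by have [l + _] := form_neq0 (hA z j) Azj; have := Nc j; lia.
Qed.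

(** A row with k z > e is 0 in the columns of degree e. At a point where the first
block of G is nonzero, such rows are independent vectors of K^(e-1) orthogonal
to it. *)
Lemma few_large_degrees r (k : 'I_r -> int) (G : 'cV[R]_conormal_rank) (A :
  'M[R]_(r, conormal_rank)) :
  kernel_basis (fun j : 'I_conormal_rank => normal_degree j) k G A ->
  usubmx (G : 'cV_(e.-1 + (n - e))) != 0 -> (#|[pred z | (e%:Z < k z)%R]| <= e - 2)%N.
Proof.
move=> [hA AG fA] Gu; set Y := [pred z | _].
have [j [l Gjl]] : exists (j : 'I_e.-1) (l : 'I_1), usubmx (G : 'cV_(e.-1 + (n - e))) j l != 0.
  apply: contrapT => h; case/eqP: Gu; apply/matrixP => j l; rewrite [RHS]mxE.
  by apply/eqP; apply: contraT => h'; case: h; exists j, l.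
have [v v0 Gv] := meval_neq0 Gjl.
pose Gv' : 'cV[K]_(e.-1 + (n - e)) := mx_at v G.
pose B : 'M[K]_(#|Y|, e.-1 + (n - e)) := rowsub (@enum_val _ Y) (mx_at v A).
have fB : row_free B by apply: row_free_rowsub; [exact: enum_val_inj|exact: fA].
have Br : rsubmx B = 0.
  apply/matrixP => z z'; rewrite !mxE.
  suff -> : A (enum_val z) (rshift e.-1 z') = 0 by rewrite meval0.
  apply/eqP; apply: contraT => nz; have [i] := form_neq0 (hA _ _) nz.
  have := enum_valP z; rewrite inE /normal_degree /= ltnNge leq_addr /=; lia.
have BG : lsubmx B *m usubmx Gv' = 0.
  have : B *m Gv' = 0.
    rewrite /B mul_rowsub_mx -mx_atM AG; apply/matrixP => z z'; rewrite !mxE meval0 //.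
  by rewrite -{1}[B]hsubmxK -{1}[Gv']vsubmxK mul_row_col Br mul0mx addr0.
have fC : row_free (lsubmx B).
  apply: inj_row_free => y yB; apply: (row_free_inj fB).
  by rewrite mul0mx -[B]hsubmxK Br mul_mx_row yB mulmx0 row_mx0.
have := mulmx0_rank_max BG; rewrite (eqP fC).
have : (0 < \rank (usubmx Gv'))%N.
  rewrite lt0n mxrank_eq0; apply: contraNneq Gv => Gu0.
  by have /matrixP/(_ j l) := Gu0; rewrite !mxE => ->.
lia.
Qed.

Lemma classification_E' : (3 <= d)%N ->
  (forall (a : (e - 2).-tuple nat) (b : (n - e).-tuple nat),
     (\sum_(ai <- a) ai + \sum_(bj <- b) bj)%N = (e * (d - 1) - 2)%N ->
     ~ sheaf_iso (normal_sheaf e F) (bundle_E K e a b)) ->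
  (e < n - 1)%N /\
  exists b : (n - e - 1).-tuple nat,
    (\sum_(bj <- b) bj)%N = (e * (d - 1))%N /\
    sheaf_iso (normal_sheaf e F) (bundle_E' K e b).
Proof.
move=> hd nE; case: (hF) => F0 hdF IF _.
have [G [hG GE nG]] := conormal_forms; have G0 := nowhere_zero_neq0 nG.
have [r [k [A [rm kb sumk]]]] := kernel_basis_ex hG nG.
have edE := degree_split hd.
have [Gu|Gu] := eqVneq (usubmx (G : 'cV_(e.-1 + (n - e)))) 0; last first.
  have few := few_large_degrees kb Gu.
  (* Listing the degrees above e first, position e - 2 separates the a_i from the
     b_j. *)
  pose s := map k (enum 'I_r); pose big (x : int) := e%:Z < x.
  pose ks := filter big s ++ filter (predC big) s.
  have pe : perm_eq ks s by rewrite perm_filterC.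
  have sz : size ks = r by rewrite (perm_size pe) size_map size_enum_ord.
  have [A' kb'] := kernel_basis_seq kb pe.
  have szb : (size (filter big s) <= e - 2)%N.
    rewrite size_filter count_map; apply: leq_trans few; rewrite cardE size_filter.
    by rewrite -enumT; apply: sub_count => z.
  have ks2 x : x \in ks -> x <= e%:Z + 2.
    rewrite (perm_mem pe) => /mapP[z _ ->].
    apply: (row_degree_le kb) => j; rewrite /normal_degree; case: ifP => _; lia.
  have re : r = (e - 2 + (n - e))%N by move: rm; rewrite /conormal_rank; lia.
  have dr x : x \in drop (e - 2) ks -> x <= e%:Z.
    rewrite drop_cat ltnNge szb /= => /mem_drop; rewrite mem_filter => /andP[+ _].
    by rewrite /= /big -leNgt.
  pose a := [seq absz (e%:Z + 2 - x)%R | x <- take (e - 2) ks].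
  pose b := [seq absz (e%:Z - x)%R | x <- drop (e - 2) ks].
  have sa : size a == (e - 2)%N by rewrite size_map size_take sz re; case: ltnP; lia.
  have sb : size b == (n - e)%N by rewrite size_map size_drop sz re; lia.
  have E : [seq e%:Z + 2 - ai%:Z | ai <- a] ++ [seq e%:Z - bj%:Z | bj <- b] = ks.
    rewrite -[RHS](cat_take_drop (e - 2)) -!map_comp; congr (_ ++ _).
      rewrite -[RHS]map_id; apply/eq_in_map => x /mem_take /ks2 /=; lia.
    rewrite -[RHS]map_id; apply/eq_in_map => x /dr /=; lia.
  have sum_ks : \sum_(x <- ks) x = \sum_(z < r) k z.
    by rewrite (perm_big _ pe) /= big_map big_enum.
  case: (nE (Tuple sa) (Tuple sb)); last first.
    by rewrite /bundle_E /= E; apply: (normal_sheaf_split IF rm erefl sz (fun _ =>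
      erefl) GE G0 kb').
  rewrite /=; move: sum_ks; rewrite -E big_cat /=
    !sum_map_sub (eqP sa) (eqP sb) sumk sum_normal_degree -(PoszM e d).
  move: (degree_bound hd); rewrite -edE PoszD (_ : e.-1%:Z = (e - 2)%N%:Z + 1); last by lia.
  move: (\sum_(z <- a) z)%N (\sum_(z <- b) z)%N (e * (d - 1))%N => s1 s2 f fb H.
  move/eqP: H; rewrite -subr_eq0 (_ : _ - _ = f%:Z - 2 - s1%:Z - s2%:Z); last by ring.
  by move=> /eqP H; lia.
pose G2 := dsubmx (G : 'cV_(e.-1 + (n - e))).
have GG : G = col_mx (0 : 'cV_e.-1) G2 by rewrite -Gu vsubmxK.
have nG2 : nowhere_zero G2.
  move=> v v0; apply: contraNneq (nG v v0) => G2v.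
  by rewrite GG /mx_at map_col_mx -/(mx_at v G2) G2v map_mx0 col_mx0.
have hG2 j : form (e%:Z * d%:Z - e%:Z) (G2 j 0).
  by rewrite mxE; have := hG (rshift e.-1 j); rewrite /normal_degree /= ltnNge leq_addr.
have [r2 [k2 [A2 [r2E kb2 sumk2]]]] := kernel_basis_ex (N := fun=> e%:Z) hG2 nG2.
have r2n : r2 = (n - e - 1)%N by lia.
subst r2; have k2e := row_degree_le kb2 (fun _ => lexx _).
pose b := [tuple absz (e%:Z - k2 z)%R | z < n - e - 1].
have bE (z : 'I_(n - e - 1)) : (nth 0%N b z)%:Z = e%:Z - k2 z.
  by rewrite -tnth_nth tnth_mktuple; have := k2e z; lia.
have sumb : (\sum_(bj <- b) bj)%N = (e * (d - 1))%N.
  have : \sum_(u <- [seq e%:Z - z%:Z | z <- b]) u = \sum_z k2 z.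
    rewrite big_map (big_nth 0%N) size_tuple big_mkord; apply: eq_bigr => z _.
    by rewrite bE; lia.
  rewrite sum_map_sub size_tuple sumk2 sum_const_int -(PoszM e d) -edE.
  move: (\sum_(z <- b) z)%N (e * (d - 1))%N => s1 f; rewrite PoszD => H.
  have w1 : (n - e)%N%:Z = (n - e - 1)%N%:Z + 1 by lia.
  move/eqP: H; rewrite -subr_eq0 w1 (_ : _ - _ = f%:Z - s1%:Z); last by ring.
  by move=> /eqP H; lia.
have en : (e < n - 1)%N.
  rewrite ltnNge; apply/negP => h; have n1 : (n - e - 1 = 0)%N by lia.
  move: sumb; have -> : tval b = [::] by apply: size0nil; rewrite size_tuple.
  rewrite big_nil; have : (0 < e * (d - 1))%N by rewrite muln_gt0; lia.
  by case: (e * (d - 1))%N.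
split=> //; exists b; split=> //.
have kb' : kernel_basis (fun=> e%:Z) (fun z : 'I_(n - e - 1) => e%:Z - (b`_z)%R%:Z) G2 A2.
  by apply: kernel_basis_eq kb2 => // z; rewrite bE; lia.
have := kernel_basis_E' kb'; rewrite -GG => kb3.
apply: (normal_sheaf_split IF _ erefl _ (fun _ => erefl) GE G0 kb3).
  by rewrite /conormal_rank; lia.
by rewrite size_cat size_nseq size_map size_tuple; lia.
Qed.

End Classification.

End Conormal.

Theorem theorem1p1 (K : closedFieldType) (n e d : nat)
    (he : (2 <= e)%N) (hen : (e <= n)%N) (hd : (3 <= d)%N) :
  (* (a) *)
  (forall (a : (e - 2).-tuple nat) (b : (n - e).-tuple nat),
     (\sum_(ai <- a) ai + \sum_(bj <- b) bj)%N = (e * (d - 1) - 2)%N ->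
     exists F : {mpoly K[n.+1]},
       hypersurface_smooth_along_rnc e d F /\
       sheaf_iso (normal_sheaf e F) (bundle_E K e a b))
  /\
  (* (b) *)
  (forall F : {mpoly K[n.+1]},
     hypersurface_smooth_along_rnc e d F ->
     (forall (a : (e - 2).-tuple nat) (b : (n - e).-tuple nat),
        (\sum_(ai <- a) ai + \sum_(bj <- b) bj)%N = (e * (d - 1) - 2)%N ->
        ~ sheaf_iso (normal_sheaf e F) (bundle_E K e a b)) ->
     (e < n - 1)%N /\
     exists b : (n - e - 1).-tuple nat,
       (\sum_(bj <- b) bj)%N = (e * (d - 1))%N /\
       sheaf_iso (normal_sheaf e F) (bundle_E' K e b))
  /\
  ((e < n - 1)%N ->
   forall b : (n - e - 1).-tuple nat,
     (\sum_(bj <- b) bj)%N = (e * (d - 1))%N ->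
     exists F : {mpoly K[n.+1]},
       hypersurface_smooth_along_rnc e d F /\
       sheaf_iso (normal_sheaf e F) (bundle_E' K e b)).
Proof.
split=> [a b sumab|]; first exact: bundle_E_realized.
split=> [F hF nE|en b sumb]; first exact: (classification_E' he hen hF hd nE).
exact: bundle_E'_realized.
Qed.
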